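(* Let $a\in\mathbb R$ and let $\gamma$ be a real root of $4a(3a-1)z^2+4(3a-1)z+3$. Then the commutator-free Runge-Kutta scheme $$g_1=e,\quad g_2=\exp\big(\tfrac h3 f_1\big),\quad g_3=\exp\big(h(a f_1+a_{32}f_2)\big),\quad a_{32}=\big(\tfrac23-2a\big)(a\gamma+1),\quad f_r=f(\Lambda(g_r,p))\ (r=1,2,3),$$ $$y_{n+1}=\Lambda\Big(\exp\Big(h\Big(\big((3a-1)\gamma+\tfrac23\big)f_1-3a\gamma f_2+\gamma f_3\Big)\Big)\exp\big(\tfrac h3 f_1\big),p\Big)$$ (which reuses the exponential of the second stage as the first exponential of the update) has order $3$. Moreover, writing $c_3=a+a_{32}$ and $f_4=f(y_{n+1})$, the embedded approximation $$\hat y_{n+1}=\Lambda\Big(\exp\Big(h\sum_{k=1}^4\hat\beta^kf_k\Big),p\Big)$$ has order $2$ whenever $\sum_{k=1}^4\hat\beta^k=1$ and $\tfrac13\hat\beta^2+c_3\hat\beta^3+\hat\beta^4=\frac12$, giving embedded pairs of order 3(2).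
   Context: Setting. Let $G$ be a Lie group with Lie algebra $\mathfrak g$ and identity $e$, $M$ a smooth manifold, $\Lambda:G\times M\to M$ a smooth left action with infinitesimal action $\lambda_*(u)(q)=\frac{d}{dt}\big|_{t=0}\Lambda(\exp(tu),q)$, $u\in\mathfrak g$, and $f:M\to\mathfrak g$ smooth. The scheme approximates the solution of $y'=\big(\lambda_*f(y)\big)(y)$ with step size $h$ starting from the point $p=y_n\in M$. Order. Let $\hat\varphi_h:M\to M$ be the map taking $p$ to the approximation computed by one step of a scheme ($y_{n+1}$ or $\hat y_{n+1}$) and $\varphi_h$ the exact time-$h$ flow. The scheme (given by its coefficients) has order $q$ if $\psi(\varphi_h(p))-\psi(\hat\varphi_h(p))=\mathcal O(h^{q+1})$ as $h\to0$ for all $C^\infty$ functions $\psi$ on $M$, all initial points $p$, and all such problems (all $G,M,\Lambda,f$). In particular ''order $q$'' means order at least $q$. An embedded pair of order 3(2) consists of $y_{n+1}$ of order 3 and $\hat y_{n+1}$ of order 2 sharing the same stages; here $\hat y_{n+1}$ may use $f(y_{n+1})$, which is the first function evaluation of the next step (''first same as last''). *)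

(* Defs.v *)
From HB Require Import structures.
From mathcomp Require Import all_boot all_order all_algebra.
From mathcomp Require Import all_classical all_reals all_analysis.
Set Implicit Arguments.
Unset Strict Implicit.
Unset Printing Implicit Defensive.
Import Order.TTheory GRing.Theory Num.Theory.
Import numFieldNormedType.Exports.
Local Open Scope classical_set_scope.
Local Open Scope ring_scope.

(* Only meant for open U and finite-dimensional E, where it is the usual notion
   of a C^k map. *)
Fixpoint Ck_on (R : realType) (E F : normedModType R) (k : nat) (U : set E)
    (f : E -> F) : Prop :=
  match k with
  | 0%N => forall x, U x -> {for x, continuous f}
  | k'.+1 => (forall x, U x -> differentiable f x) /\
             (forall v : E, Ck_on k' U (fun x => 'D_v f x))
  end.

Definition smooth_on (R : realType) (E F : normedModType R) (U : set E)
    (f : E -> F) : Prop :=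
  forall k, Ck_on k U f.

(* A chart is a homeomorphism between the open sets chart_dom and chart_cod; the
   values of chart_map and chart_inv outside these sets are irrelevant. *)
Record chart (R : realType) (T : topologicalType) (E : normedModType R) := Chart {
  chart_dom : set T;
  chart_cod : set E;
  chart_map : T -> E;
  chart_inv : E -> T }.

Definition is_chart (R : realType) (T : topologicalType) (E : normedModType R)
    (c : chart T E) : Prop :=
  [/\ open (chart_dom c) /\ open (chart_cod c),
      forall x, chart_dom c x ->
        chart_cod c (chart_map c x) /\ chart_inv c (chart_map c x) = x,
      forall v, chart_cod c v ->
        chart_dom c (chart_inv c v) /\ chart_map c (chart_inv c v) = v,
      {within chart_dom c, continuous (chart_map c)} &
      {within chart_cod c, continuous (chart_inv c)}].

(* chart_at picks a preferred chart around each point x; the tangent space at x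
   is represented by the model space E, through the coordinates of that chart. *)
Record atlas (R : realType) (T : topologicalType) (E : normedModType R) := Atlas {
  charts : set (chart T E);
  chart_at : T -> chart T E }.

Definition is_manifold (R : realType) (T : topologicalType) (n : nat)
    (A : atlas T 'rV[R]_n) : Prop :=
  [/\ hausdorff_space T /\ @second_countable T,
      forall c, charts A c -> is_chart c,
      forall c d, charts A c -> charts A d ->
        smooth_on [set v | chart_cod c v /\ chart_dom d (chart_inv c v)]
                  (chart_map d \o chart_inv c) &
      forall x, charts A (chart_at A x) /\ chart_dom (chart_at A x) x].

Definition model_chart (R : realType) (E : normedModType R) : chart E E :=
  Chart setT setT id id.

Definition model_atlas (R : realType) (E : normedModType R) : atlas E E :=
  Atlas [set model_chart E] (fun=> model_chart E).

Definition prod_chart (R : realType) (S T : topologicalType)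
    (E F : normedModType R) (c : chart S E) (d : chart T F) :
    chart (S * T)%type (E * F)%type :=
  Chart (chart_dom c `*` chart_dom d) (chart_cod c `*` chart_cod d)
        (fun z => (chart_map c z.1, chart_map d z.2))
        (fun w => (chart_inv c w.1, chart_inv d w.2)).

Definition prod_atlas (R : realType) (S T : topologicalType)
    (E F : normedModType R) (A : atlas S E) (B : atlas T F) :
    atlas (S * T)%type (E * F)%type :=
  Atlas [set e | exists c d, [/\ charts A c, charts B d & e = prod_chart c d]]
        (fun z => prod_chart (chart_at A z.1) (chart_at B z.2)).

Definition smooth_map (R : realType) (S T : topologicalType)
    (E F : normedModType R) (A : atlas S E) (B : atlas T F) (f : S -> T) : Prop :=
  continuous f /\
  forall c d, charts A c -> charts B d ->
    smooth_on [set v | chart_cod c v /\ chart_dom d (f (chart_inv c v))]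
              (chart_map d \o f \o chart_inv c).

(* v : E stands for a tangent vector at y t. *)
Definition has_velocity (R : realType) (T : topologicalType)
    (E : normedModType R) (A : atlas T E) (y : R -> T) (t : R) (v : E) : Prop :=
  {for t, continuous y} /\
  is_derive (t : R^o) (1 : R^o) (chart_map (chart_at A (y t)) \o y) v.

(* No compatibility is required here between the topology and the group law; it
   comes from is_lie_group. *)
#[short(type="topGroupCarrierType")]
HB.structure Definition TopGroupCarrier := {G of Topological G & Group G}.

Definition is_lie_group (R : realType) (G : topGroupCarrierType) (n : nat)
    (A : atlas G 'rV[R]_n) : Prop :=
  [/\ is_manifold A,
      smooth_map (prod_atlas A A) A (fun z : G * G => (z.1 * z.2)%g) &
      smooth_map A A (fun x : G => (x^-1)%g)].

(* The Lie algebra, i.e. the tangent space of G at 1, is 'rV_n through the chart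
   chart_at A 1. The map exp is characterized by: for each u, t |-> exp (t u) is
   the one-parameter subgroup with initial velocity u. *)
Definition is_exponential (R : realType) (G : topGroupCarrierType) (n : nat)
    (A : atlas G 'rV[R]_n) (exp : 'rV[R]_n -> G) : Prop :=
  forall u : 'rV[R]_n,
    [/\ smooth_map (model_atlas R^o) A (fun t : R^o => exp (t *: u)),
        forall s t : R, exp ((s + t) *: u) = (exp (s *: u) * exp (t *: u))%g &
        has_velocity A (fun t => exp (t *: u)) 0 u].

Definition is_smooth_action (R : realType) (G : topGroupCarrierType) (n : nat)
    (A : atlas G 'rV[R]_n) (M : topologicalType) (m : nat)
    (B : atlas M 'rV[R]_m) (act : G -> M -> M) : Prop :=
  [/\ forall q, act 1%g q = q,
      forall g k q, act (g * k)%g q = act g (act k q) &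
      smooth_map (prod_atlas A B) B (fun z : G * M => act z.1 z.2)].

Record problem (R : realType) := Problem {
  pb_group : topGroupCarrierType;
  pb_gdim : nat;
  pb_gatlas : atlas pb_group 'rV[R]_pb_gdim;
  pb_exp : 'rV[R]_pb_gdim -> pb_group;
  pb_space : topologicalType;
  pb_dim : nat;
  pb_atlas : atlas pb_space 'rV[R]_pb_dim;
  pb_act : pb_group -> pb_space -> pb_space;
  pb_f : pb_space -> 'rV[R]_pb_gdim;
  pb_groupP : is_lie_group pb_gatlas;
  pb_expP : is_exponential pb_gatlas pb_exp;
  pb_spaceP : is_manifold pb_atlas;
  pb_actP : is_smooth_action pb_gatlas pb_atlas pb_act;
  pb_fP : smooth_map pb_atlas (model_atlas 'rV[R]_pb_gdim) pb_f }.

(* lambda_*(u)(q), a tangent vector at q *)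
Definition lambda_star (R : realType) (P : problem R) (u : 'rV[R]_(pb_gdim P))
    (q : pb_space P) : 'rV[R]_(pb_dim P) :=
  derive1 (fun t : R =>
    chart_map (chart_at (pb_atlas P) q) (pb_act (pb_exp (t *: u)) q)) 0.

(* The flow of y' = lambda_*(f(y))(y) need not be complete, so that phi t p is
   only constrained for t close to 0, how close depending on p. *)
Definition is_exact_flow (R : realType) (P : problem R)
    (phi : R -> pb_space P -> pb_space P) : Prop :=
  forall p, phi 0 p = p /\
    \forall t \near (0 : R), has_velocity (pb_atlas P) (fun s => phi s p) t
      (lambda_star (pb_f (phi t p)) (phi t p)).

(* A scheme sends a problem, a step size and a point to the approximation
   produced by one step. *)
Definition scheme (R : realType) : Type :=
  forall P : problem R, R -> pb_space P -> pb_space P.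

Definition has_order (R : realType) (q : nat) (Phi : scheme R) : Prop :=
  forall (P : problem R) (phi : R -> pb_space P -> pb_space P),
    is_exact_flow phi ->
  forall psi : pb_space P -> R^o,
    smooth_map (pb_atlas P) (model_atlas R^o) psi ->
  forall p : pb_space P,
    (fun h : R => psi (phi h p) - psi (Phi P h p)) =O_ (nbhs (0 : R))
    (fun h : R => h ^+ q.+1 : R^o).

Section CommutatorFree.
Context (R : realType) (a gamma : R).

Definition cf3_a32 : R := (2 / 3 - 2 * a) * (a * gamma + 1).

Definition cf3_c3 : R := a + cf3_a32.

Definition cf3_f1 (P : problem R) (p : pb_space P) : 'rV[R]_(pb_gdim P) :=
  pb_f (pb_act 1%g p).

Definition cf3_g2 (P : problem R) (h : R) (p : pb_space P) : pb_group P :=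
  pb_exp ((h / 3) *: cf3_f1 p).

Definition cf3_f2 (P : problem R) (h : R) (p : pb_space P) :
    'rV[R]_(pb_gdim P) :=
  pb_f (pb_act (cf3_g2 h p) p).

Definition cf3_g3 (P : problem R) (h : R) (p : pb_space P) : pb_group P :=
  pb_exp (h *: (a *: cf3_f1 p + cf3_a32 *: cf3_f2 h p)).

Definition cf3_f3 (P : problem R) (h : R) (p : pb_space P) :
    'rV[R]_(pb_gdim P) :=
  pb_f (pb_act (cf3_g3 h p) p).

Definition cf3_update : scheme R := fun P h p =>
  pb_act (pb_exp (h *: (((3 * a - 1) * gamma + 2 / 3) *: cf3_f1 p
                        - (3 * a * gamma) *: cf3_f2 h p
                        + gamma *: cf3_f3 h p))
          * pb_exp ((h / 3) *: cf3_f1 p))%g p.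

Definition cf3_f4 (P : problem R) (h : R) (p : pb_space P) :
    'rV[R]_(pb_gdim P) :=
  pb_f (cf3_update h p).

Definition cf3_embedded (b1 b2 b3 b4 : R) : scheme R := fun P h p =>
  pb_act (pb_exp (h *: (b1 *: cf3_f1 p + b2 *: cf3_f2 h p
                        + b3 *: cf3_f3 h p + b4 *: cf3_f4 h p))) p.

End CommutatorFree.

(* Main.v *)
(** Fix the starting point p. For a smooth psi near p and u in the Lie algebra,
    d/dt psi (exp (t u) q) = (X_u psi) (exp (t u) q), where X_u = sum_i u_i X_i
    is linear in u. Hence psi (exp (t u) q) has the Taylor expansion
    sum_k t^k / k! (X_u^k psi) q, uniformly for bounded u and q near p, and the
    exact solution is expanded by iterating (psi o y)' = sum_i f_i(y) X_i psi (y).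
    Both expansions are formal power series in h whose coefficients are linear
    combinations of the functionals psi |-> X_v ... X_u psi (p); comparing them
    up to h^3 leaves exactly four order conditions on the coefficients, all
    of which follow from the quadratic equation satisfied by gamma.

    Only the one-parameter subgroups t |-> exp (t u) are known to be smooth, so
    uniformity in u does not come from smoothness of exp: it is obtained by a
    continuation argument for the flow in a single chart around p. *)

From HB Require Import structures.
Require Import Defs.
From mathcomp Require Import all_boot all_order all_algebra.
From mathcomp Require Import all_classical all_reals all_analysis.
From mathcomp Require Import ring lra.
Set Implicit Arguments.
Unset Strict Implicit.
Unset Printing Implicit Defensive.
Import Order.TTheory GRing.Theory Num.Theory.
Import numFieldNormedType.Exports.
Local Open Scope classical_set_scope.
Local Open Scope ring_scope.

(** * Mean value estimates on real segments *)

Section MeanValue.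
Context {R : realType}.

Lemma le_norm_derive_segment (g g' : R -> R) (C a b : R) : a <= b ->
  (forall s, a <= s <= b -> is_derive s (1 : R) g (g' s)) ->
  (forall s, a <= s <= b -> `|g' s| <= C) ->
  `|g b - g a| <= C * (b - a).
Proof.
move=> ab dg bg; have [s|s|c cab ->] := @MVT_segment R g g' a b ab.
- by rewrite in_itv/= => /andP[as_ sb]; apply: dg; rewrite !ltW.
- apply/continuous_in_subspaceT => x; rewrite inE/= in_itv/= => /dg dgx.
  by apply: differentiable_continuous; apply/derivable1_diffP.
- rewrite normrM (ger0_norm (_ : 0 <= b - a)) ?subr_ge0// ler_wpM2r ?subr_ge0//.
  by apply: bg; rewrite in_itv/= in cab.
Qed.

(** Times may be negative: the segment between 0 and [t], on either side, lies in the symmetric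
    interval of the hypotheses. *)
Lemma le_norm_derive (g g' : R -> R) (C t : R) :
  (forall s, `|s| <= `|t| -> is_derive s (1 : R) g (g' s)) ->
  (forall s, `|s| <= `|t| -> `|g' s| <= C) ->
  `|g t - g 0| <= C * `|t|.
Proof.
move=> dg bg; have [t0|t0] := leP 0 t.
  have le_t s : 0 <= s <= t -> `|s| <= `|t|.
    by move=> /andP[s0 st]; rewrite !ger0_norm.
  rewrite -[X in C * X]subr0 [X in C * (X - _)]ger0_norm//.
  by apply: (@le_norm_derive_segment g g') => // s /le_t; [exact: dg|exact: bg].
have le_t s : t <= s <= 0 -> `|s| <= `|t|.
  by move=> /andP[ts s0]; rewrite !ler0_norm ?lerN2// ltW.
rewrite distrC [X in C * X]ltr0_norm// -[X in C * X]sub0r.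
apply: (@le_norm_derive_segment g g'); first exact: ltW.
  by move=> s /le_t/dg.
by move=> s /le_t/bg.
Qed.

End MeanValue.

(** * Asymptotic expansions at 0 *)

Section Jets.
Context {R : realType}.
Implicit Types (g : R -> R) (c : nat -> R) (N : nat).

(** [Oh 0] is boundedness near 0. The neighbourhoods contain 0 itself, so a positive [N] forces
    [g 0 = 0]. The sign of [C] is left free. *)
Definition Oh N g : Prop :=
  exists C : R, \forall h \near (0 : R), `|g h| <= C * `|h| ^+ N.

Lemma near0_norm_lt (d : R) : 0 < d -> \forall h \near (0 : R), `|h| < d.
Proof. by exists d => // h /=; rewrite sub0r normrN. Qed.

Lemma near0P (P : set R) : (\forall h \near (0 : R), P h) ->
  exists2 d, 0 < d & forall h, `|h| < d -> P h.
Proof.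
by move=> [d d0 H]; exists d => // h hd; apply: H => /=; rewrite sub0r normrN.
Qed.

Lemma ext_Oh N g1 g2 : g1 =1 g2 -> Oh N g1 -> Oh N g2.
Proof. by move=> /funext ->. Qed.

Lemma OhD N g1 g2 : Oh N g1 -> Oh N g2 -> Oh N (fun h => g1 h + g2 h).
Proof.
move=> [C H] [D K]; exists (C + D); near=> h.
rewrite (le_trans (ler_normD _ _))// mulrDl lerD//; by near: h.
Unshelve. all: by end_near. Qed.

Lemma OhM N K g1 g2 : Oh N g1 -> Oh K g2 -> Oh (N + K) (fun h => g1 h * g2 h).
Proof.
move=> [C H] [D L]; exists (C * D); near=> h.
rewrite normrM exprD mulrACA ler_pM//; by near: h.
Unshelve. all: by end_near. Qed.

Lemma Oh0 N : Oh N (fun=> 0).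
Proof. by exists 0; near=> h; rewrite normr0 mul0r. Unshelve. all: by end_near. Qed.

Lemma Oh_cst (k : R) : Oh 0 (fun=> k).
Proof.
by exists `|k|; near=> h; rewrite expr0 mulr1. Unshelve. all: by end_near. Qed.

Lemma OhX N : Oh N (fun h => h ^+ N).
Proof.
by exists 1; near=> h; rewrite mul1r normrX. Unshelve. all: by end_near. Qed.

Lemma OhZ N k g : Oh N g -> Oh N (fun h => k * g h).
Proof. by move=> Og; have := OhM (Oh_cst k) Og. Qed.

Lemma OhN N g : Oh N g -> Oh N (fun h => - g h).
Proof.
by move=> /(OhZ (-1)); apply: ext_Oh => h; rewrite mulN1r.
Qed.

Lemma Oh_sum (I : Type) (r : seq I) (P : pred I) N (F : I -> R -> R) :
  (forall i, P i -> Oh N (F i)) -> Oh N (fun h => \sum_(i <- r | P i) F i h).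
Proof.
move=> H; elim: r => [|i r IHr].
  by apply: ext_Oh (Oh0 N) => h; rewrite big_nil.
case Pi : (P i).
  apply: ext_Oh (OhD (H i Pi) IHr) => h.
  by rewrite big_cons Pi.
by apply: ext_Oh IHr => h; rewrite big_cons Pi.
Qed.

Lemma Oh_leq N K g : (N <= K)%N -> Oh K g -> Oh N g.
Proof.
move=> NK [C H]; exists (Num.max C 0); near=> h.
have h1 : `|h| <= 1 by apply: ltW; near: h; exact: near0_norm_lt.
apply: (@le_trans _ _ (C * `|h| ^+ K)); first by near: h.
apply: (@le_trans _ _ (Num.max C 0 * `|h| ^+ K)).
  by rewrite ler_wpM2r ?exprn_ge0// le_max lexx.
by rewrite ler_wpM2l ?le_max ?lexx ?orbT// ler_wiXn2l.
Unshelve. all: by end_near. Qed.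

(** By the mean value inequality between 0 and [h], the bound on the derivative gains one factor
    [|h|]. *)
Lemma Oh_int N g g' : g 0 = 0 -> (\forall t \near (0 : R), is_derive t (1 : R) g (g' t)) ->
  Oh N g' -> Oh N.+1 g.
Proof.
move=> g0 dg [C H]; exists C.
have /near0P[d d0 Hd] : \forall t \near (0 : R), is_derive t (1 : R) g (g' t) /\
    `|g' t| <= C * `|t| ^+ N by near=> t; split; near: t.
(* The sign of [C] is read off at the point [d / 2], where the power is positive. *)
have C0 : 0 <= C.
  have d2 : 0 < d / 2 by rewrite divr_gt0.
  have [|_ /(le_trans (normr_ge0 _))] := Hd (d / 2).
    by rewrite gtr0_norm// ltr_pdivrMr// mulr_natr mulr2n ltrDl.
  by rewrite pmulr_lge0// exprn_gt0// gtr0_norm.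
near=> h.
have hd : `|h| < d by near: h; exact: near0_norm_lt.
have sd (s : R) : `|s| <= `|h| -> `|s| < d by move=> /le_lt_trans; apply.
rewrite -[g h]subr0 -g0 exprSr mulrA; apply: (@le_norm_derive _ g g').
  by move=> s /sd/Hd[].
move=> s sh; have [_ /le_trans] := Hd _ (sd _ sh); apply.
by rewrite ler_wpM2l// lerXn2r// nnegrE.
Unshelve. all: by end_near. Qed.

(** An asymptotic expansion rather than a Taylor formula: [c k] carries no factorial, and [g] may
    fail to be differentiable away from 0. *)
Definition jet N g c : Prop := Oh N (fun h => g h - \sum_(k < N) c k * h ^+ k).

Lemma jet_eq N g c c' : (forall k, (k < N)%N -> c k = c' k) -> jet N g c -> jet N g c'.
Proof.
move=> e; apply: ext_Oh => h; congr (_ - _).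
by apply: eq_bigr => k _; rewrite e.
Qed.

Lemma ext_jet N g g' c : g =1 g' -> jet N g c -> jet N g' c.
Proof. by move=> /funext ->. Qed.

Lemma jet_Oh0 N g c : jet N g c -> Oh 0 g.
Proof.
move=> /(Oh_leq (leq0n N)) J.
have : Oh 0 (fun h => \sum_(k < N) c k * h ^+ k).
  by apply: Oh_sum => k _; apply: OhZ; apply: Oh_leq (OhX k).
move=> /(OhD J); apply: ext_Oh => h; by rewrite subrK.
Qed.

Lemma jet_leq N K g c : (N <= K)%N -> jet K g c -> jet N g c.
Proof.
move=> NK J.
have : Oh N (fun h => \sum_(i < K | (N <= i)%N) c i * h ^+ i).
  by apply: Oh_sum => i Ni; apply: OhZ; apply: Oh_leq (OhX i).
move=> /(OhD (Oh_leq NK J)); apply: ext_Oh => h.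
rewrite (big_ord_widen K (fun k => c k * h ^+ k) NK).
rewrite (bigID (fun i : 'I_K => (i < N)%N))/= opprD -!addrA; congr (_ + _).
rewrite [X in _ + (- X + _)](eq_bigl (fun i : 'I_K => (N <= i)%N)).
  by rewrite addNr addr0.
by move=> i; rewrite -leqNgt.
Qed.

Lemma jetD N g g' c c' : jet N g c -> jet N g' c' ->
  jet N (fun h => g h + g' h) (fun k => c k + c' k).
Proof.
move=> /OhD J /J; apply: ext_Oh => h.
rewrite addrACA -opprD -big_split/=; congr (_ - _).
by apply: eq_bigr => k _; rewrite mulrDl.
Qed.

Lemma jet0 N : jet N (fun=> 0) (fun=> 0).
Proof.
apply: ext_Oh (Oh0 N) => h.
by rewrite big1 ?subr0// => i _; rewrite mul0r.
Qed.

Lemma jetZ N k g c : jet N g c -> jet N (fun h => k * g h) (fun i => k * c i).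
Proof.
move=> /(OhZ k); apply: ext_Oh => h.
rewrite mulrBr mulr_sumr; congr (_ - _).
by apply: eq_bigr => i _; rewrite mulrA.
Qed.

Lemma jet_sum (I : Type) (r : seq I) N (F : I -> R -> R) (c : I -> nat -> R) :
  (forall i, jet N (F i) (c i)) ->
  jet N (fun h => \sum_(i <- r) F i h) (fun k => \sum_(i <- r) c i k).
Proof.
move=> H; elim: r => [|i r IHr].
  apply: (@ext_jet _ (fun=> 0)); first by move=> h; rewrite big_nil.
  by apply: (@jet_eq _ _ (fun=> 0)) (jet0 N) => k _; rewrite big_nil.
apply: (@ext_jet _ (fun h => F i h + \sum_(i <- r) F i h)).
  by move=> h; rewrite big_cons.
by apply: jet_eq (jetD (H i) IHr) => k _; rewrite big_cons.
Qed.

Definition conv c c' k : R := \sum_(i < k.+1) c i * c' (k - i)%N.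

Lemma Oh_horner N (p : {poly R}) : (forall i, (i < N)%N -> p`_i = 0) ->
  Oh N (fun h => p.[h]).
Proof.
move=> p0.
have : Oh N (fun h => \sum_(i < size p) p`_i * h ^+ i).
  apply: Oh_sum => i _; have [iN|Ni] := ltnP i N.
    by rewrite p0//; apply: ext_Oh (Oh0 N) => h; rewrite mul0r.
  by apply: OhZ; apply: Oh_leq (OhX i).
by apply: ext_Oh => h; rewrite horner_coef.
Qed.

(** With [p], [q], [r] the truncated expansions of [g], [g'] and of the product, [g g' - r = (g - p)
    g' + p (g' - q) + (p q - r)]. The first two terms are small by hypothesis, and [p q - r] is a
    polynomial without terms of degree below [N]. *)
Lemma jetM N g g' c c' : jet N g c -> jet N g' c' ->
  jet N (fun h => g h * g' h) (conv c c').
Proof.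
move=> J J'.
pose p := \poly_(k < N) c k; pose q := \poly_(k < N) c' k.
pose r := \poly_(k < N) conv c c' k.
have O1 : Oh N (fun h => (g h - \sum_(k < N) c k * h ^+ k) * g' h).
  by rewrite -[N in Oh N]addn0; exact: OhM J (jet_Oh0 J').
have O2 : Oh N (fun h => p.[h] * (g' h - \sum_(k < N) c' k * h ^+ k)).
  rewrite -[N in Oh N]add0n; apply: OhM J'.
  by apply: Oh_horner.
have O3 : Oh N (fun h => (p * q - r).[h]).
  apply: Oh_horner => i iN; rewrite coefB coefM coef_poly iN.
  apply/eqP; rewrite subr_eq0; apply/eqP.
  apply: eq_bigr => j _; rewrite !coef_poly.
  have jN : (j < N)%N by rewrite (leq_ltn_trans _ iN)// -ltnS.
  by rewrite jN (leq_ltn_trans (leq_subr _ _) iN).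
apply: ext_Oh (OhD O1 (OhD O2 O3)) => h.
rewrite hornerD hornerN hornerM !horner_poly.
move: (\sum_(k < N) c k * h ^+ k) (\sum_(k < N) c' k * h ^+ k) => S S'; ring.
Qed.

Definition primc (g0 : R) c (k : nat) : R :=
  if k is k'.+1 then c k' / k'.+1%:R else g0.

(** The truncation with coefficients [primc] differentiates to the truncation for [g'], so [Oh_int]
    applies to the difference and raises the order by one. *)
Lemma jet_int N g g' c :
  (\forall t \near (0 : R), is_derive t (1 : R) g (g' t)) ->
  jet N g' c -> jet N.+1 g (primc (g 0) c).
Proof.
move=> dg J; apply: (Oh_int _ _ J).
  rewrite big_ord_recl /= expr0 mulr1 big1 ?addr0 ?subrr// => i _.
  by rewrite expr0n/= mulr0.
pose p := \poly_(k < N.+1) primc (g 0) c k.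
have -> : (fun h => g h - \sum_(k < N.+1) primc (g 0) c k * h ^+ k) = g - horner p.
  by apply/funext => h; rewrite -horner_poly.
near=> t.
have -> : \sum_(k < N) c k * t ^+ k = p^`().[t].
  rewrite (@horner_coef_wide _ N).
    apply: eq_bigr => k _; rewrite coef_deriv coef_poly ltnS ltn_ord.
    by rewrite -mulr_natr divfK// pnatr_eq0.
  apply/leq_sizeP => j Nj.
  by rewrite coef_deriv coef_poly ltnS ltnNge Nj mul0rn.
have dgt : is_derive t (1 : R) g (g' t) by near: t.
exact: is_deriveB.
Unshelve. all: by end_near. Qed.

Lemma jet_cst N (k : R) : jet N (fun=> k) (fun i => if i is 0%N then k else 0).
Proof.
apply: (@ext_Oh _ (fun h => (k%:P - \poly_(i < N) (if i is 0%N then k else 0)).[h])).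
  by move=> h; rewrite hornerD hornerN hornerC horner_poly.
apply: Oh_horner => i iN; rewrite coefB coefC coef_poly iN.
by case: i {iN} => [|i]; rewrite /= subrr.
Qed.

Lemma jet_Oh_sub N (g g' : R -> R) c : jet N g c -> jet N g' c -> Oh N (fun h => g h - g' h).
Proof.
move=> J /OhN /(OhD J); apply: ext_Oh => h.
by rewrite opprB addrA subrK.
Qed.

Lemma jet_shift N m (g : R -> R) c : jet N g c ->
  jet (m + N) (fun h => h ^+ m * g h) (fun k => if (m <= k)%N then c (k - m)%N else 0).
Proof.
move=> /(OhM (OhX m)); apply: ext_Oh => h; rewrite mulrBr; congr (_ - _).
rewrite big_split_ord/= [X in _ = X + _]big1 ?add0r; last first.
  by move=> i _; rewrite leqNgt ltn_ord mul0r.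
rewrite mulr_sumr; apply: eq_bigr => i _.
by rewrite leq_addr addKn exprD mulrCA.
Qed.

Lemma near0_normM_lt1 (L : R) : 0 < L -> \forall h \near (0 : R), `|h| * L < 1.
Proof.
move=> L0; have : 0 < L^-1 by rewrite invr_gt0.
move=> /near0_norm_lt H; near=> h; rewrite -ltr_pdivlMr// mul1r; near: h.
exact: H.
Unshelve. all: by end_near. Qed.

End Jets.

(** * Lie series *)

Section LieSeries.
Context {R : realType} {n : nat} {M : Type}.
Variable X : 'I_n -> (M -> R) -> (M -> R).

Definition functional : Type := (M -> R) -> R^o.
HB.instance Definition _ := GRing.Lmodule.copy functional ((M -> R) -> R^o).

(* The derivations compose in reverse order:
   lie u (lie w (dirac_at q)) psi = (X_w (X_u psi)) q. *)
Definition lie (u : 'rV[R]_n) (Phi : functional) : functional :=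
  fun psi => \sum_i u 0 i * Phi (X i psi).

(** [M] has no linear structure, so a moving point is expanded through its evaluation functional. *)
Definition dirac_at (q : M) : functional := fun psi => psi q.

Lemma functional_sumE (I : Type) (r : seq I) (P : pred I) (F : I -> functional) psi :
  (\sum_(i <- r | P i) F i) psi = \sum_(i <- r | P i) F i psi.
Proof. exact: (big_morph (fun Phi : functional => Phi psi)). Qed.

Lemma lieDl u v Phi : lie (u + v) Phi = lie u Phi + lie v Phi.
Proof.
apply/funext => psi; rewrite -[RHS]/(lie u Phi psi + lie v Phi psi) -big_split/=.
by apply: eq_bigr => i _; rewrite mxE mulrDl.
Qed.

Lemma lieDr u Phi Psi : lie u (Phi + Psi) = lie u Phi + lie u Psi.
Proof.
apply/funext => psi; rewrite -[RHS]/(lie u Phi psi + lie u Psi psi) -big_split/=.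
by apply: eq_bigr => i _; rewrite mulrDr.
Qed.

Lemma lieZl k u Phi : lie (k *: u) Phi = k *: lie u Phi.
Proof.
apply/funext => psi; rewrite -[RHS]/(k * lie u Phi psi) mulr_sumr.
by apply: eq_bigr => i _; rewrite mxE mulrA.
Qed.

Lemma lieZr k u Phi : lie u (k *: Phi) = k *: lie u Phi.
Proof.
apply/funext => psi; rewrite -[RHS]/(k * lie u Phi psi) mulr_sumr.
by apply: eq_bigr => i _; rewrite mulrCA.
Qed.

Lemma lie0l Phi : lie 0 Phi = 0.
Proof. by apply/funext => psi; rewrite /lie big1// => i _; rewrite mxE mul0r. Qed.

Lemma lie0r u : lie u 0 = 0.
Proof. by apply/funext => psi; rewrite /lie big1// => i _; rewrite mulr0. Qed.

(** The Cauchy product for the bilinear map [lie]: it gives the coefficients of [lie v Phi] from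
    those of [v] and [Phi]. *)
Definition lieconv (c : nat -> 'rV[R]_n) (e : nat -> functional) (k : nat) :
  functional := \sum_(j < k.+1) lie (c j) (e (k - j)%N).

(* The coefficients of sum_m h^m / m! (lie v)^m Phi when v and Phi have the
   coefficients c and e. *)
Definition flowc (c : nat -> 'rV[R]_n) (e : nat -> functional) (k : nat) :
  functional := \sum_(m < k.+1) (m`!%:R)^-1 *: iter m (lieconv c) e (k - m)%N.

Variables (f : M -> 'rV[R]_n).

(** Applied to the coefficients of [dirac_at (q h)], it yields those of [f (q h)]. *)
Definition vec (Phi : functional) : 'rV[R]_n := \row_i Phi (fun q => f q 0 i).

Lemma vecD Phi Psi : vec (Phi + Psi) = vec Phi + vec Psi.
Proof. by apply/rowP => i; rewrite !mxE. Qed.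

Lemma vecZ k Phi : vec (k *: Phi) = k *: vec Phi.
Proof. by apply/rowP => i; rewrite !mxE. Qed.

(* Picard iteration for (psi o y)' = sum_i f_i(y) X_i psi (y), on coefficients. *)
Definition exactc (p : M) (e : nat -> functional) (k : nat) : functional :=
  if k is k'.+1 then (k'.+1%:R)^-1 *: lieconv (vec \o e) e k' else dirac_at p.

End LieSeries.

(** What the expansions use about the flows of the fields [lie X u]: [A] is a set of test functions
    stable under the derivations, the derivative formula holds as long as the flow stays in [D], and
    [lf_local] confines the flow for short times, uniformly in bounded [u] and in starting points
    near [p]. *)
Record local_flow {R : realType} {n : nat} {M : topologicalType} (p : M)
    (A : set (M -> R)) (X : 'I_n -> (M -> R) -> (M -> R))
    (fl : 'rV[R]_n -> R -> M -> M) : Prop := {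
  lf_closed : forall i psi, A psi -> A (X i psi);
  lf_bounded : forall psi, A psi ->
    exists C : R, \forall q \near p, `|psi q| <= C;
  lf_start : forall u q, fl u 0 q = q;
  lf_derive : exists2 D, nbhs p D & forall psi u q t, A psi -> D (fl u t q) ->
    is_derive t (1 : R) (fun s => psi (fl u s q))
      (lie X u (dirac_at (fl u t q)) psi);
  lf_local : forall (K : R) V, 0 <= K -> nbhs p V -> exists2 L : R, 0 < L &
    \forall q \near p, forall (u : 'rV[R]_n) (t : R),
      (forall i, `|u 0 i| <= K) -> `|t| * L < 1 -> V (fl u t q) }.

(** * Expansions of flows, of the field and of the exact solution *)

Section Expansions.
Context {R : realType} {n : nat} {M : topologicalType} (p : M).
Variables (A : set (M -> R)) (X : 'I_n -> (M -> R) -> (M -> R)).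
Variables (fl : 'rV[R]_n -> R -> M -> M).
Hypothesis LF : local_flow p A X fl.

Local Notation functional := (@functional R M).
Local Notation lie := (lie X).

Definition jetf N (D : R -> functional) (e : nat -> functional) :=
  forall psi, A psi -> jet N (fun h => D h psi) (fun k => e k psi).

Definition jetv N (v : R -> 'rV[R]_n) (c : nat -> 'rV[R]_n) :=
  forall i, jet N (fun h => v h 0 i) (fun k => c k 0 i).

Lemma jetf_eq N D e e' : (forall k, (k < N)%N -> e k = e' k) ->
  jetf N D e -> jetf N D e'.
Proof. by move=> ee J psi Apsi; apply: jet_eq (J psi Apsi) => k /ee ->. Qed.

Lemma jetv_eq N v c c' : (forall k, (k < N)%N -> c k = c' k) ->
  jetv N v c -> jetv N v c'.
Proof. by move=> ee J i; apply: jet_eq (J i) => k /ee ->. Qed.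

Lemma jetf_leq N K D e : (N <= K)%N -> jetf K D e -> jetf N D e.
Proof. by move=> NK J psi Apsi; apply: jet_leq (J psi Apsi). Qed.

Lemma jetv_leq N K v c : (N <= K)%N -> jetv K v c -> jetv N v c.
Proof. by move=> NK J i; apply: jet_leq (J i). Qed.

Lemma jetvD N v c v' c' : jetv N v c -> jetv N v' c' ->
  jetv N (fun h => v h + v' h) (fun k => c k + c' k).
Proof.
move=> J J' i; apply: (ext_jet _ (jet_eq _ (jetD (J i) (J' i)))) => [h|k _];
  by rewrite mxE.
Qed.

Lemma jetvZ N a v c : jetv N v c -> jetv N (fun h => a *: v h) (fun k => a *: c k).
Proof.
move=> J i; apply: (ext_jet _ (jet_eq _ (jetZ a (J i)))) => [h|k _];
  by rewrite mxE.
Qed.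

Lemma jetv_cst N w : jetv N (fun=> w) (fun i => if i is 0%N then w else 0).
Proof.
by move=> i; apply: jet_eq (jet_cst N (w 0 i)) => -[|k] _; rewrite ?mxE.
Qed.

Lemma jetf_cst N Phi : jetf N (fun=> Phi) (fun i => if i is 0%N then Phi else 0).
Proof. by move=> psi _; apply: jet_eq (jet_cst N (Phi psi)) => -[|k] _. Qed.

Lemma jetf_lie N v c D e : jetv N v c -> jetf N D e ->
  jetf N (fun h => lie (v h) (D h)) (lieconv X c e).
Proof.
move=> Jv JD psi Apsi.
have := jet_sum (index_enum 'I_n) (fun i => jetM (Jv i) (JD _ (lf_closed LF i Apsi))).
by apply: jet_eq => k _; rewrite /lieconv exchange_big/= functional_sumE.
Qed.

Lemma jetf_iter N m v c D e : jetv N v c -> jetf N D e ->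
  jetf N (fun h => iter m (lie (v h)) (D h)) (iter m (lieconv X c) e).
Proof. by move=> Jv JD; elim: m => //= m IHm; apply: jetf_lie. Qed.

Variable f : M -> 'rV[R]_n.
Hypothesis Af : forall i, A (fun q => f q 0 i).

Lemma jetv_field N q e : jetf N (fun h => dirac_at (q h)) e ->
  jetv N (fun h => f (q h)) (vec f \o e).
Proof. by move=> J i; apply: jet_eq (J _ (Af i)) => k _; rewrite mxE. Qed.

(** Picard iteration: local boundedness starts the induction at order 0, and each integration of the
    differential equation gains one order. *)
Lemma jetf_exact (y : R -> M) : y 0 = p -> y t @[t --> (0 : R)] --> p ->
  (forall psi, A psi -> \forall t \near (0 : R),
    is_derive t (1 : R) (fun s => psi (y s)) (lie (f (y t)) (dirac_at (y t)) psi)) ->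
  forall N, jetf N (fun h => dirac_at (y h)) (iter N (exactc X f p) (fun=> 0)).
Proof.
move=> y0 yp dy; elim=> [psi Apsi|N IHN psi Apsi].
  have [C HC] := lf_bounded LF Apsi.
  exists C; near=> h; rewrite big_ord0 subr0 expr0 mulr1.
  by near: h; exact: (yp _ HC).
have := jet_int (dy psi Apsi) (jetf_lie (jetv_field IHN) IHN Apsi).
apply: jet_eq => -[|k] _ /=; first by rewrite y0.
by rewrite /GRing.scale/= mulrC.
Unshelve. all: by end_near. Qed.

(* L is both the constant of the estimate and the inverse of its radius of
   validity: the estimate is then monotone in L, so that finitely many of them
   are merged by adding the constants. *)
Lemma fl_taylor N K psi : 0 <= K -> A psi -> exists2 L : R, 0 < L &
  \forall q \near p, forall (u : 'rV[R]_n) (t : R), (forall i, `|u 0 i| <= K) -> `|t| * L < 1 ->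
    `|psi (fl u t q) -
      \sum_(k < N) t ^+ k / k`!%:R * iter k (lie u) (dirac_at q) psi|
    <= L * `|t| ^+ N.
Proof.
move=> K0; elim: N psi => [|N IHN] psi Apsi.
  have [C HC] := lf_bounded LF Apsi.
  have [L L0 HL] := lf_local LF K0 HC.
  exists (L + `|C|); first by rewrite ltr_wpDr.
  apply: filterS HL => q Hq u t uK tL.
  rewrite big_ord0 subr0 expr0 mulr1.
  rewrite (le_trans (Hq u t uK _))//.
    rewrite (le_lt_trans _ tL)// ler_wpM2l// lerDl//.
  by rewrite (le_trans (ler_norm _))// lerDr ltW.
have [D Dp dD] := lf_derive LF.
have [L1 L10 HL1] := lf_local LF K0 Dp.
have /choice[L HL] i : exists L : R, 0 < L /\
  \forall q \near p, forall (u : 'rV[R]_n) (t : R), (forall i, `|u 0 i| <= K) -> `|t| * L < 1 ->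
    `|X i psi (fl u t q) -
      \sum_(k < N) t ^+ k / k`!%:R * iter k (lie u) (dirac_at q) (X i psi)|
    <= L * `|t| ^+ N.
  by have [L L0 HL] := IHN _ (lf_closed LF i Apsi); exists L.
pose S := \sum_i L i.
have S0 : 0 <= S by apply: sumr_ge0 => i _; apply: ltW; have [] := HL i.
have LS i : L i <= S.
  rewrite /S (bigD1 i)//= lerDl; apply: sumr_ge0 => j _.
  by apply: ltW; have [] := HL j.
(* [L1] keeps the flow in [D], [S] dominates the constants of all the [X i psi], and [K * S] bounds
   their combination with the entries of [u]. *)
exists (L1 + S + K * S).
  by rewrite -addrA ltr_wpDr// addr_ge0// mulr_ge0.
have : \forall q \near p, forall i (u : 'rV[R]_n) (t : R),
    (forall i, `|u 0 i| <= K) -> `|t| * L i < 1 ->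
    `|X i psi (fl u t q) -
      \sum_(k < N) t ^+ k / k`!%:R * iter k (lie u) (dirac_at q) (X i psi)|
    <= L i * `|t| ^+ N.
  by apply: filter_forall => i; have [] := HL i.
move=> HLq; near=> q => u t uK tL.
have H1 : forall (u : 'rV[R]_n) (t : R), (forall i, `|u 0 i| <= K) -> `|t| * L1 < 1 -> D (fl u t q).
  by near: q.
have H2 : forall i (u : 'rV[R]_n) (t : R),
    (forall i, `|u 0 i| <= K) -> `|t| * L i < 1 ->
    `|X i psi (fl u t q) -
      \sum_(k < N) t ^+ k / k`!%:R * iter k (lie u) (dirac_at q) (X i psi)|
    <= L i * `|t| ^+ N.
  by near: q.
have KS0 : 0 <= K * S by rewrite mulr_ge0.
have small l s : l <= L1 + S + K * S -> `|s| <= `|t| -> `|s| * l < 1.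
  move=> lL st; rewrite (le_lt_trans _ tL)//.
  apply: (@le_trans _ _ (`|s| * (L1 + S + K * S))).
    by rewrite ler_wpM2l.
  by rewrite ler_wpM2r//; lra.
(* The derivative of the remainder [g] is the combination [g'] of the remainders of order [N] of the
   functions [X i psi]; the mean value inequality then supplies the missing factor [|t|]. *)
pose g s := psi (fl u s q) -
   \sum_(k < N.+1) s ^+ k / k`!%:R * iter k (lie u) (dirac_at q) psi.
pose g' s := \sum_i u 0 i * (X i psi (fl u s q) -
   \sum_(k < N) s ^+ k / k`!%:R * iter k (lie u) (dirac_at q) (X i psi)).
have g0 : g 0 = 0.
  rewrite /g (lf_start LF) big_ord_recl/= expr0 fact0 divr1 mul1r big1 ?addr0 ?subrr//.
  by move=> i _; rewrite expr0n/= !mul0r.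
rewrite -[X in `|X|]/(g t) -[g t]subr0 -g0.
have := @le_norm_derive R g g' ((L1 + S + K * S) * `|t| ^+ N) t.
rewrite -mulrA -exprSr; apply => [s st|s st].
  have sL1 : `|s| * L1 < 1 by apply: small => //; lra.
  have ds := dD _ _ _ _ Apsi (H1 u s uK sL1).
  pose P := \poly_(k < N.+1) (k`!%:R^-1 * iter k (lie u) (dirac_at q) psi).
  have -> : g = (fun s => psi (fl u s q)) - horner P.
    apply/funext => x; rewrite /g; congr (_ - _).
    rewrite horner_poly; apply: eq_bigr => k _.
    by rewrite [_ / _]mulrC mulrAC.
  have -> : g' s = lie u (dirac_at (fl u s q)) psi - P^`().[s].
    rewrite (@horner_coef_wide _ N); last first.
      apply/leq_sizeP => j Nj.
      by rewrite coef_deriv coef_poly ltnS ltnNge Nj mul0rn.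
    transitivity (lie u (dirac_at (fl u s q)) psi -
        \sum_i \sum_(k < N) s ^+ k / k`!%:R *
          (u 0 i * iter k (lie u) (dirac_at q) (X i psi))).
      rewrite /g' /lie -sumrB; apply: eq_bigr => i _.
      rewrite mulrBr; congr (_ - _); rewrite mulr_sumr.
      by apply: eq_bigr => k _; rewrite mulrCA.
    rewrite exchange_big/=; congr (_ - _); apply: eq_bigr => k _.
    (* The sum over [i] is the outermost [lie u] of the iterate of order [k.+1], which hands
       [X i psi] to the inner iterate of order [k]. *)
    rewrite -mulr_sumr coef_deriv coef_poly ltnS ltn_ord -[X in _ * X]/(lie u _ psi).
    rewrite -[X in _ = X * _]mulr_natr factS natrM invfM.
    have k0 : k.+1%:R != 0 :> R by rewrite pnatr_eq0.
    have kf0 : k`!%:R != 0 :> R by rewrite pnatr_eq0 -lt0n fact_gt0.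
    rewrite iterS; move: (k.+1%:R) (k`!%:R) k0 kf0 => a b a0 b0.
    by field; rewrite a0 b0.
  exact: is_deriveB.
apply: (le_trans (ler_norm_sum _ _ _)).
apply: (@le_trans _ _ (\sum_i K * (L i * `|t| ^+ N))).
  apply: ler_sum => i _; rewrite normrM ler_pM//.
  have sLi : `|s| * L i < 1 by apply: small => //; have := LS i; lra.
  apply: (le_trans (H2 i u s uK sLi)).
  have Li0 : 0 <= L i by apply: ltW; have [] := HL i.
  by rewrite ler_wpM2l// lerXn2r// nnegrE.
rewrite -mulr_sumr -mulr_suml -/S mulrA ler_wpM2r ?exprn_ge0//.
by lra.
Unshelve. all: by end_near. Qed.

Lemma jetv_bounded N v c : jetv N v c ->
  exists2 K : R, 0 <= K & \forall h \near (0 : R), forall i, `|v h 0 i| <= K.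
Proof.
move=> Jv.
have /choice[C HC] i : exists C : R, \forall h \near (0 : R), `|v h 0 i| <= C.
  have [C HC] := jet_Oh0 (Jv i); exists C; near=> h.
  by rewrite -[C]mulr1 -[1](expr0 `|h|); near: h.
exists (\sum_i `|C i|); first exact: sumr_ge0.
have : \forall h \near (0 : R), forall i, `|v h 0 i| <= C i.
  exact: (@filter_forall _ _ (fun i h => `|v h 0 i| <= C i) (nbhs (0 : R)) _ HC).
move=> H; near=> h => i.
have Hh : forall i, `|v h 0 i| <= C i by near: h.
rewrite (le_trans (Hh i))// (le_trans (ler_norm _))//.
by rewrite (bigD1 i)//= lerDl sumr_ge0.
Unshelve. all: by end_near. Qed.

Lemma fl_cvg N v c (q : R -> M) : jetv N v c -> q h @[h --> (0 : R)] --> p ->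
  fl (v h) h (q h) @[h --> (0 : R)] --> p.
Proof.
move=> /jetv_bounded[K K0 vK] qp V /(lf_local LF K0)[L L0 HL].
have H := qp _ HL; change (\forall h \near (0 : R), V (fl (v h) h (q h))).
near=> h; have Hq : forall (u : 'rV[R]_n) (t : R), (forall i, `|u 0 i| <= K) ->
  `|t| * L < 1 -> V (fl u t (q h)) by near: h.
apply: Hq; first by near: h.
by near: h; exact: near0_normM_lt1.
Unshelve. all: by end_near. Qed.

(** Since [fl_taylor] is uniform in the field and the starting point, [v h] and [q h] may be
    substituted into it; what remains is the expansion of the Taylor polynomial [T]. *)
Lemma jetf_fl N v c (q : R -> M) e : jetv N v c -> q h @[h --> (0 : R)] --> p ->
  jetf N.+1 (fun h => dirac_at (q h)) e ->
  jetf N.+1 (fun h => dirac_at (fl (v h) h (q h))) (flowc X c e).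
Proof.
move=> Jv qp Jq psi Apsi.
pose T h := \sum_(m < N.+1) (m`!%:R)^-1 * (h ^+ m * iter m (lie (v h)) (dirac_at (q h)) psi).
have JT : jet N.+1 T (fun k => flowc X c e k psi).
  have : forall m : 'I_N.+1, jet N.+1
     (fun h => h ^+ m * iter m (lie (v h)) (dirac_at (q h)) psi)
     (fun k => if (m <= k)%N then iter m (lieconv X c) e (k - m)%N psi else 0).
    (* The term of index 0 does not involve [v]; every other one carries a positive power of [h],
       which is why [v] is expanded to one order less than [q]. *)
    move=> [[|m] mN]/=.
      apply: (ext_jet _ (jet_eq _ (Jq psi Apsi))) => [h|k _]; first by rewrite mul1r.
      by rewrite subn0.
    apply: (@jet_leq _ _ (m.+1 + N)); first by rewrite addSn ltnS leq_addl.
    exact: (jet_shift m.+1 (jetf_iter m.+1 Jv (jetf_leq (leqnSn N) Jq) Apsi)).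
  move=> H.
  have := jet_sum (index_enum 'I_N.+1) (fun m : 'I_N.+1 => jetZ (m`!%:R)^-1 (H m)).
  apply: jet_eq => k kN /=.
  rewrite /flowc [RHS](_ : _ = \sum_(m < k.+1) m`!%:R^-1 * iter m (lieconv X c) e (k - m)%N psi).
    rewrite (big_ord_widen N.+1 (fun m => m`!%:R^-1 * iter m (lieconv X c) e (k - m)%N psi))//.
    rewrite [RHS]big_mkcond/=; apply: eq_bigr => m _; rewrite ltnS.
    by case: ifP; rewrite ?mulr0.
  by rewrite functional_sumE.
have [K K0 vK] := jetv_bounded Jv.
have [L L0 HL] := fl_taylor N.+1 K0 Apsi.
have : Oh N.+1 (fun h => psi (fl (v h) h (q h)) - T h).
  have H := qp _ HL; exists L; near=> h.
  rewrite /T (eq_bigr (fun k : 'I_N.+1 =>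
    h ^+ k / k`!%:R * iter k (lie (v h)) (dirac_at (q h)) psi)).
    have Hq : forall (u : 'rV[R]_n) (t : R), (forall i, `|u 0 i| <= K) ->
      `|t| * L < 1 -> `|psi (fl u t (q h)) -
      \sum_(k < N.+1) t ^+ k / k`!%:R * iter k (lie u) (dirac_at (q h)) psi|
       <= L * `|t| ^+ N.+1 by near: h.
    apply: Hq; first by near: h.
    by near: h; exact: near0_normM_lt1.
  by move=> m _; rewrite mulrA [_ / _]mulrC.
move=> /OhD /(_ JT); apply: ext_Oh => h.
by rewrite addrA subrK.
Unshelve. all: by end_near. Qed.

End Expansions.

(** * Order conditions *)

Section Coefficients.
Context {R : realType} {n : nat} {M : Type} (p : M).
Variables (X : 'I_n -> (M -> R) -> (M -> R)) (f : M -> 'rV[R]_n).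
Local Notation functional := (@functional R M).
Local Notation lie := (lie X).
Local Notation vec := (vec f).
Implicit Types (c : nat -> 'rV[R]_n) (e : nat -> functional).

Lemma lieconvE c e :
  [/\ lieconv X c e 0 = lie (c 0%N) (e 0%N),
      lieconv X c e 1 = lie (c 0%N) (e 1%N) + lie (c 1%N) (e 0%N) &
      lieconv X c e 2 = lie (c 0%N) (e 2%N) + lie (c 1%N) (e 1%N) + lie (c 2%N) (e 0%N)].
Proof. by rewrite /lieconv; split; rewrite !big_ord_recr big_ord0/= add0r ?subSS ?subn0. Qed.

Lemma flowcE c e :
  [/\ flowc X c e 0 = e 0%N,
      flowc X c e 1 = e 1%N + lie (c 0%N) (e 0%N),
      flowc X c e 2 = e 2%N + (lie (c 0%N) (e 1%N) + lie (c 1%N) (e 0%N)) +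
        2^-1 *: lie (c 0%N) (lie (c 0%N) (e 0%N)) &
      flowc X c e 3 = e 3%N +
        (lie (c 0%N) (e 2%N) + lie (c 1%N) (e 1%N) + lie (c 2%N) (e 0%N)) +
        2^-1 *: (lie (c 0%N) (lie (c 0%N) (e 1%N) + lie (c 1%N) (e 0%N)) +
                 lie (c 1%N) (lie (c 0%N) (e 0%N))) +
        6^-1 *: lie (c 0%N) (lie (c 0%N) (lie (c 0%N) (e 0%N)))].
Proof.
have L := lieconvE c; have [E0 E1 E2] := L e.
have [D0 D1 _] := L (lieconv X c e).
have [C0 _ _] := L (lieconv X c (lieconv X c e)).
rewrite /flowc; split; rewrite !big_ord_recr big_ord0/= add0r ?subSS ?subn0;
  rewrite -?[1`!]/1%N -?[0`!]/1%N -?[2`!]/2%N -?[3`!]/6%N ?invr1 ?scale1r//.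
- by rewrite E0.
- by rewrite E1 D0 E0.
- by rewrite E2 D1 E1 E0 C0 D0 E0.
Qed.

Let F := f p.
Let ev : functional := dirac_at p.
Let F1 := vec (lie F ev).
Let F2 := vec (lie F1 ev + lie F (lie F ev)).

(** Here [F1] and [F2] stand for the first and second derivatives at 0 of [f] along the exact
    solution. *)
Definition exact_coef (k : nat) : functional := nth 0 [:: ev; lie F ev;
  2^-1 *: (lie F1 ev + lie F (lie F ev));
  6^-1 *: (lie F2 ev + lie F (lie F1 ev) + 2 *: lie F1 (lie F ev)
           + lie F (lie F (lie F ev)))] k.

Lemma vec_ev : vec ev = F.
Proof. by apply/rowP => i; rewrite mxE. Qed.

(** Coefficient [k.+1] of an iterate depends only on coefficients up to [k] of the previous one, so
    [N] iterations settle all coefficients below [N]. *)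
Lemma exactcE N k : (k < N)%N -> (k < 4)%N ->
  iter N (exactc X f p) (fun=> 0) k = exact_coef k.
Proof.
elim: N k => // N IHN [|k]//; rewrite ltnS iterS => kN k3 /=.
have eE j : (j < k.+1)%N -> iter N (exactc X f p) (fun=> 0) j = exact_coef j.
  by move=> jk; apply: IHN; apply: leq_trans jk _ => //; exact: ltnW.
have -> : lieconv X (vec \o iter N (exactc X f p) (fun=> 0))
    (iter N (exactc X f p) (fun=> 0)) k = lieconv X (vec \o exact_coef) exact_coef k.
  apply: eq_bigr => j _; rewrite /= !eE// ltnS ?leq_subr// -ltnS.
have [E0 E1 E2] := lieconvE (vec \o exact_coef) exact_coef.
have v1 : vec (exact_coef 1) = F1 by [].
have v2 : vec (exact_coef 2) = 2^-1 *: F2 by rewrite [LHS]vecZ.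
move: k k3 {kN eE} => [|[|[|k]]]// _.
- by rewrite E0 /= vec_ev invr1 scale1r.
- by rewrite E1 /= vec_ev -/F1; congr (_ *: _); exact: addrC.
- rewrite E2; rewrite [(vec \o _) 2%N]v2 [(vec \o _) 1%N]v1 [(vec \o _) 0%N]vec_ev.
  rewrite /exact_coef /= !(lieZr, lieZl, lieDr, lieDl).
  apply/funext => psi; rewrite !fctE /GRing.scale/=.
  by field.
Qed.

End Coefficients.

(** * Expansions of the stages and of both approximations *)

Section Order.
Context {R : realType} {n : nat} {M : topologicalType} (p : M).
Variables (A : set (M -> R)) (X : 'I_n -> (M -> R) -> (M -> R)).
Variables (fl : 'rV[R]_n -> R -> M -> M) (f : M -> 'rV[R]_n).
Hypothesis LF : local_flow p A X fl.
Hypothesis Af : forall i, A (fun q => f q 0 i).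
Local Notation functional := (@functional R M).
Local Notation lie := (lie X).
Local Notation vec := (vec f).
Let F := f p.
Let ev : functional := dirac_at p.
Let F1 := vec (lie F ev).
Let F2a := vec (lie F (lie F ev)).
Let F2b := vec (lie F1 ev).

Lemma jetf_fl_at N v c : jetv N v c ->
  jetf A N.+1 (fun h => dirac_at (fl (v h) h p))
    (flowc X c (fun k => if k is 0%N then dirac_at p else 0)).
Proof.
move=> Jv; apply: (jetf_fl LF Jv); first exact: cvg_cst.
exact: jetf_cst.
Qed.

Lemma fl_at_cvg N v c : jetv N v c -> fl (v h) h p @[h --> (0 : R)] --> p.
Proof. by move=> Jv; apply: (fl_cvg LF Jv); exact: cvg_cst. Qed.

(** The exponential series of a constant field. The bound on [N] matters: [nth] returns 0 beyond the
    four listed coefficients. *)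
Lemma stage2_jet (k : R) N : (N <= 4)%N ->
  jetf A N (fun h => dirac_at (fl (k *: F) h p)) (nth 0 [:: ev; k *: lie F ev;
    (k ^+ 2 / 2) *: lie F (lie F ev);
    (k ^+ 3 / 6) *: lie F (lie F (lie F ev))]).
Proof.
move=> N4; apply: (jetf_leq N4).
have := jetf_fl_at (jetv_cst 3 (k *: F)); apply: jetf_eq.
have [E0 E1 E2 E3] := flowcE X (fun i => if i is 0%N then k *: F else 0)
  (fun i => if i is 0%N then ev else 0).
move=> [|[|[|[|i]]]]// _; rewrite ?E0 ?E1 ?E2 ?E3 ?(lie0l, lie0r, lieZl, lieZr,
  scaler0, add0r, addr0)//;
  apply/funext => psi; rewrite !fctE /GRing.scale/=; by field.
Qed.

(** The inner stage is expanded to order 2 only, as the flow gains one order. The second-order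
    coefficient separates into [F2b], due to the variation of the inner stage, and [F2a], due to
    iterating the constant field. *)
Lemma stage3_jet (a b k : R) (w : R -> 'rV[R]_n) :
  w = (fun h => a *: F + b *: f (fl (k *: F) h p)) ->
  jetv 3 (fun h => f (fl (w h) h p))
    (nth 0 [:: F; (a + b) *: F1; (b * k) *: F2b + ((a + b) ^+ 2 / 2) *: F2a]).
Proof.
move=> ->.
have J2 := jetvZ b (jetv_field Af (@stage2_jet k 2 isT)).
have := jetv_field Af (jetf_fl_at (jetvD (jetvZ a (jetv_cst 2 F)) J2)).
apply: jetv_eq.
set c := (X in flowc _ X _).
have [E0 E1 E2 E3] := flowcE X c (fun i => if i is 0%N then ev else 0).
have c0 : c 0%N = (a + b) *: F by rewrite /c /= vec_ev scalerDl.
have c1 : c 1%N = (b * k) *: F1 by rewrite /c /= vecZ scaler0 add0r scalerA.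
move=> [|[|[|i]]]// _ /=; rewrite ?E0 ?E1 ?E2 ?c0 ?c1 ?(lie0l, lie0r, lieZl, lieZr,
  scaler0, add0r, addr0) ?vecD ?vecZ ?vec_ev//.
by apply/rowP => i; rewrite !mxE; field.
Qed.

Variables (b1 b2 b3 a a32 k : R).
Definition cf_f2 h := f (fl (k *: F) h p).
Definition cf_f3 h := f (fl (a *: F + a32 *: cf_f2 h) h p).
Definition cf_v h := b1 *: F + b2 *: cf_f2 h + b3 *: cf_f3 h.
Definition cf_upd h := fl (cf_v h) h (fl (k *: F) h p).

(** [order1] completes the weight [k] of the first exponential to 1, [order2] fixes the coefficient
    of [F1], and [order3a] and [order3b] fix those of [F2b] and [F2a]. *)
Hypothesis k3 : k = 3^-1.
Hypothesis order1 : b1 + b2 + b3 = 2 / 3.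
Hypothesis order2 : b2 / 3 + b3 * (a + a32) = 1 / 2.
Hypothesis order3a : b3 * a32 / 3 = 1 / 6.
Hypothesis order3b : b2 / 9 + b3 * (a + a32) ^+ 2 = 1 / 3.

(** Added to [h / 3] times [F], the exponent [h] times [cf_v h] agrees up to [h ^+ 3] with the
    integral of [f] along the exact solution. *)
Lemma cf_v_jet : jetv 3 cf_v (nth 0 [:: (2 / 3) *: F; 2^-1 *: F1; 6^-1 *: (F2b + F2a)]).
Proof.
have J1 := jetvZ b1 (jetv_cst 3 F).
have J2 := jetvZ b2 (jetv_field Af (@stage2_jet k 3 isT)).
have J3 := jetvZ b3 (@stage3_jet a a32 k _ erefl).
have := jetvD (jetvD J1 J2) J3.
apply: jetv_eq => -[|[|[|i]]]// _ /=.
- by rewrite vec_ev -/F -!scalerDl; congr (_ *: _); exact: order1.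
- rewrite scaler0 add0r vecZ !scalerA -scalerDl; congr (_ *: _).
  by rewrite k3 order2 div1r.
- rewrite scaler0 add0r vecZ -/F2a; move: F2a F2b => x y.
  apply/rowP => i; rewrite !mxE k3.
  transitivity ((b3 * a32 / 3) * y 0 i + ((b2 / 9 + b3 * (a + a32) ^+ 2) / 2) * x 0 i).
    by field.
  by rewrite order3a order3b; field.
Qed.

(** The split of the total weight into 1/3 and 2/3 gives [lie F (lie F1 ev)] and [lie F1 (lie F ev)]
    their unequal exact weights 1/6 and 1/3; a single exponential would give 1/4 to both. *)
Lemma cf_upd_jet : jetf A 4 (fun h => dirac_at (cf_upd h)) (exact_coef p X f).
Proof.
have J := jetf_fl LF cf_v_jet (fl_at_cvg (jetv_cst 3 (k *: F))) (@stage2_jet k 4 isT).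
apply: jetf_eq J.
set c := (X in flowc _ X _); set e := (X in flowc _ _ X).
have [E0 E1 E2 E3] := flowcE X c e.
move=> [|[|[|[|i]]]]// _ /=; rewrite ?E0 ?E1 ?E2 ?E3 /c /e /exact_coef /= -/F -/ev -/F1
  ?vecD ?(lieZl, lieZr, lieDl, lieDr) -/F2a -/F2b ?(lieZl, lieZr, lieDl, lieDr);
  apply/funext => psi; rewrite !fctE /GRing.scale/= k3; by field.
Qed.

Section Exact.
Variable y : R -> M.
Hypothesis y0 : y 0 = p.
Hypothesis yp : y t @[t --> (0 : R)] --> p.
Hypothesis dy : forall psi, A psi -> \forall t \near (0 : R),
  is_derive t (1 : R) (fun s => psi (y s)) (lie (f (y t)) (dirac_at (y t)) psi).

Lemma exact_jet N : (N <= 4)%N ->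
  jetf A N (fun h => dirac_at (y h)) (exact_coef p X f).
Proof.
move=> N4; have := jetf_exact LF Af y0 yp dy N; apply: jetf_eq => i iN.
by rewrite exactcE// (leq_trans iN).
Qed.

Lemma cf_upd_order psi : A psi -> Oh 4 (fun h => psi (y h) - psi (cf_upd h)).
Proof.
move=> Apsi; exact: (jet_Oh_sub (@exact_jet 4 isT _ Apsi) (cf_upd_jet Apsi)).
Qed.

Variables (d1 d2 d3 d4 : R).
Hypothesis emb1 : d1 + d2 + d3 + d4 = 1.
Hypothesis emb2 : d2 / 3 + (a + a32) * d3 + d4 = 1 / 2.

Definition cf_emb h :=
  fl (d1 *: F + d2 *: cf_f2 h + d3 *: cf_f3 h + d4 *: f (cf_upd h)) h p.

(** Up to [h ^+ 2] no product of distinct fields occurs, so one exponential suffices: its exponent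
    has to be [F] plus [h / 2] times [F1], and this is what [emb1] and [emb2] say. *)
Lemma cf_emb_order psi : A psi -> Oh 3 (fun h => psi (y h) - psi (cf_emb h)).
Proof.
move=> Apsi; apply: (jet_Oh_sub (@exact_jet 3 isT _ Apsi)).
have J1 := jetvZ d1 (jetv_cst 2 F).
have J2 := jetvZ d2 (jetv_field Af (@stage2_jet k 2 isT)).
have J3 := jetvZ d3 (jetv_leq _ (@stage3_jet a a32 k _ erefl)).
have J4 := jetvZ d4 (jetv_field Af (jetf_leq _ cf_upd_jet)).
have := jetf_fl_at (jetvD (jetvD (jetvD J1 J2) (J3 2 isT)) (J4 2 isT)).
move=> /(_ _ Apsi); apply: jet_eq => i i3.
congr (_ psi); move: i i3.
set c := (X in flowc _ X _).
have [E0 E1 E2 _] := flowcE X c (fun i => if i is 0%N then ev else 0).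
have c0 : c 0%N = F.
  by rewrite /c /= vec_ev -/F -!scalerDl emb1 scale1r.
have c1 : c 1%N = 2^-1 *: F1.
  rewrite /c /= -/F1 vecZ !scalerA scaler0 add0r -/F1 -!scalerDl; congr (_ *: _).
  by rewrite -div1r -emb2 k3; ring.
move=> [|[|[|i]]]// _ /=; rewrite ?E0 ?E1 ?E2 ?c0 ?c1 ?(lie0l, lie0r, lieZl, lieZr,
  scaler0, add0r, addr0)//.
exact: (esym (scalerDr _ _ _)).
Qed.

End Exact.

End Order.

(** * C^k maps *)

Section CkOn.
Context {R : realType} {E : normedModType R}.

(** Coordinate expressions often agree only near a point. The first-order expansion of [f] serves
    for [g], and uniqueness of the differential identifies its linear part. *)
Lemma near_eq_differentiable (F : normedModType R) (f g : E -> F) (x : E) :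
  {near x, f =1 g} -> differentiable f x -> differentiable g x.
Proof.
move=> fg /diff_locallyP[cdf df].
have dg : g \o shift x = cst (g x) + 'd f x +o_ 0 id.
  apply/eqaddoP => _/posnumP[e]; move/eqaddoP: df => /(_ e%:num [gt0 of e%:num]) df.
  have fgx : \forall y \near (0 : E), f (y + x) = g (y + x).
    by have := fg; rewrite (near_shift 0)/= subr0.
  near=> y.
  have -> : (g \o shift x - (cst (g x) + 'd f x)) y = (f \o shift x - (cst (f x) + 'd f x)) y.
    rewrite !fctE /= -(near fgx y)//; congr (_ - (_ + _)).
    exact: (esym (nbhs_singleton fg)).
  by near: y.
have dgf := diff_unique cdf dg.
by apply/diff_locallyP; rewrite dgf.
Unshelve. all: by end_near. Qed.

(** As [U] is open, equality on [U] is equality near each of its points, hence it passes to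
    directional derivatives. *)
Lemma Ck_on_eq (F : normedModType R) k (U : set E) (f g : E -> F) : open U ->
  (forall x, U x -> f x = g x) -> Ck_on k U f -> Ck_on k U g.
Proof.
move=> oU; elim: k f g => [|k IHk] f g fg.
  move=> cf x Ux; have cfx : f @ x --> f x := cf x Ux.
  suff : g @ x --> f x by rewrite (fg x Ux).
  apply: cvg_trans cfx; apply: near_eq_cvg.
  by have := open_nbhs_nbhs (conj oU Ux); apply: filterS => y /fg ->.
have fgn x : U x -> {near x, f =1 g}.
  by move=> Ux; have := open_nbhs_nbhs (conj oU Ux); apply: filterS => y /fg ->.
move=> [df Df]; split=> [x Ux|v].
  exact: near_eq_differentiable (fgn x Ux) (df x Ux).
by apply: IHk (Df v) => x Ux; apply: near_eq_derive; exact: fgn.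
Qed.

Lemma Ck_onS (F : normedModType R) k (U : set E) (f : E -> F) :
  Ck_on k.+1 U f -> Ck_on k U f.
Proof.
elim: k f => [|k IHk] f [df Df].
  by move=> x Ux; exact: differentiable_continuous (df x Ux).
by split => // v; apply: IHk; exact: Df.
Qed.

Lemma Ck_on_subset (F : normedModType R) k (U V : set E) (f : E -> F) :
  U `<=` V -> Ck_on k V f -> Ck_on k U f.
Proof.
move=> UV; elim: k f => [|k IHk] f; first by move=> cf x /UV; exact: cf.
by move=> [df Df]; split=> [x /UV|v]; [exact: df|apply: IHk; exact: Df].
Qed.

Lemma Ck_on_cst (F : normedModType R) k (U : set E) (w : F) : Ck_on k U (cst w).
Proof.
elim: k w => [|k IHk] w; first by move=> x _; exact: cvg_cst.
split=> [x _|v]; first exact: differentiable_cst.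
rewrite (_ : (fun x => _) = cst 0)//.
by apply/funext => x; rewrite derive_cst.
Qed.

Lemma Ck_onD (F : normedModType R) k (U : set E) (f g : E -> F) : open U ->
  Ck_on k U f -> Ck_on k U g -> Ck_on k U (f + g).
Proof.
move=> oU; elim: k f g => [|k IHk] f g.
  by move=> cf cg x Ux; apply: cvgD; [exact: cf|exact: cg].
move=> [df Df] [dg Dg]; split=> [x Ux|v].
  by apply: differentiableD; [exact: df|exact: dg].
apply: Ck_on_eq (IHk _ _ (Df v) (Dg v)) => // x Ux.
by rewrite deriveD//; apply: diff_derivable; [exact: df|exact: dg].
Qed.

Lemma Ck_onM k (U : set E) (f g : E -> R^o) : open U ->
  Ck_on k U f -> Ck_on k U g -> Ck_on k U (f * g).
Proof.
move=> oU; elim: k f g => [|k IHk] f g.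
  by move=> cf cg x Ux; apply: cvgM; [exact: cf|exact: cg].
move=> Cf Cg; have [df Df] := Cf; have [dg Dg] := Cg; split=> [x Ux|v].
  by apply: differentiableM; [exact: df|exact: dg].
apply: (Ck_on_eq oU _ (Ck_onD oU (IHk _ _ (Ck_onS Cf) (Dg v))
                                 (IHk _ _ (Ck_onS Cg) (Df v)))) => x Ux.
by rewrite deriveM//; apply: diff_derivable; [exact: df|exact: dg].
Qed.

Lemma smooth_on_sum (I : Type) (r : seq I) (U : set E) (f : I -> E -> R^o) :
  open U -> (forall i, smooth_on U (f i)) -> smooth_on U (fun x => \sum_(i <- r) f i x).
Proof.
move=> oU sf k; elim: r => [|i r IHr].
  rewrite (_ : (fun x => _) = cst 0); first exact: Ck_on_cst.
  by apply/funext => x; rewrite big_nil.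
rewrite (_ : (fun x => _) = f i + (fun x => \sum_(i <- r) f i x)).
  by apply: Ck_onD => //; exact: sf.
by apply/funext => x; rewrite big_cons.
Qed.

Lemma derive_coord m (f : E -> 'rV[R]_m) j x v : differentiable f x ->
  'D_v (fun y => f y 0 j : R^o) x = ('D_v f x) 0 j.
Proof. by move=> df; rewrite derive_mx ?mxE//; exact: diff_derivable. Qed.

Lemma Ck_on_coord m k (U : set E) (f : E -> 'rV[R]_m) j : open U ->
  Ck_on k U f -> Ck_on k U (fun x => f x 0 j : R^o).
Proof.
move=> oU; elim: k f => [|k IHk] f.
  move=> cf x Ux; apply: (@cvg_comp _ _ _ f (fun y : 'rV[R]_m => y 0 j : R^o) _ _ _ (cf x Ux)).
  exact: coord_continuous.
move=> [df Df]; split=> [x Ux|v].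
  apply: (@differentiable_comp _ _ _ _ f (fun y : 'rV[R]_m => y 0 j : R^o)).
    exact: df.
  exact: differentiable_coord.
by apply: Ck_on_eq (IHk _ (Df v)) => // x Ux; rewrite derive_coord//; exact: df.
Qed.

Lemma smooth_on_derive (F : normedModType R) (U : set E) (f : E -> F) v :
  smooth_on U f -> smooth_on U ('D_v f).
Proof. by move=> sf k; have [_ /(_ v)] := sf k.+1. Qed.

(** The derivative of the slice along [v] is the slice of the derivative along [(0, v)], so the
    induction avoids composing C^k maps. *)
Lemma Ck_on_slice (E' F : normedModType R) k (U : set (E' * E)%type)
    (x : E') (f : (E' * E)%type -> F) :
  Ck_on k U f -> Ck_on k [set z | U (x, z)] (fun z => f (x, z)).
Proof.
elim: k f => [|k IHk] f.
  move=> cf z Uz; apply: (@cvg_comp _ _ _ (fun z => (x, z)) f _ _ _ _ (cf _ Uz)).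
  by apply: cvg_pair; [exact: cvg_cst|exact: cvg_id].
move=> [df Df]; split=> [z Uz|v].
  apply: (@differentiable_comp _ _ _ _ (fun z => (x, z)) f); last exact: df.
  have dx : differentiable (cst x : E -> E') z by exact: differentiable_cst.
  have did : differentiable (id : E -> E) z by [].
  exact: (differentiable_pair dx did).
have -> : (fun z => 'D_v (fun z => f (x, z)) z) = (fun z => 'D_(0, v) f (x, z)).
  apply/funext => z; rewrite /derive.
  suff -> : (fun h : R => h^-1 *: (((fun z => f (x, z)) \o shift z) (h *: v) - f (x, z)))
    = (fun h : R => h^-1 *: ((f \o shift (x, z)) (h *: (0, v)) - f (x, z))) by [].
  apply/funext => h /=; congr (_ *: (f _ - _)).
  by rewrite -[RHS]/(h *: 0 + x, h *: v + z) scaler0 add0r.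
exact: (IHk _ (Df (0, v))).
Qed.

End CkOn.

(** * Chain rule along curves *)

Section ChainRule.
Context {R : realType} {V W : normedModType R}.

Lemma is_derive_comp_differentiable (k : R -> V) (g : V -> W) (t : R) (v : V) :
  is_derive (t : R^o) (1 : R^o) k v -> differentiable g (k t) ->
  is_derive (t : R^o) (1 : R^o) (g \o k) ('d g (k t) v).
Proof.
move=> dk dg; have dfk : differentiable (k : R^o -> V) t.
  by apply/derivable1_diffP; exact: ex_derive.
have dgk : differentiable (g \o k : R^o -> W) t by exact: differentiable_comp.
apply: DeriveDef; first exact: diff_derivable.
rewrite deriveE// diff_comp//= -[v](@derive_val _ _ _ _ _ _ _ dk).
by rewrite [in RHS]deriveE.
Qed.

Lemma is_derive_translate (f : R -> V) (t : R) (v : V) :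
  is_derive (0 : R^o) (1 : R^o) (fun s => f (s + t)) v ->
  is_derive (t : R^o) (1 : R^o) f v.
Proof.
have e : (fun h : R^o =>
    h^-1 *: (((fun s => f (s + t)) \o shift (0 : R^o)) (h *: (1 : R^o)) - f (0 + t)))
   = (fun h : R^o => h^-1 *: ((f \o shift (t : R^o)) (h *: (1 : R^o)) - f t)).
  by apply/funext => h /=; rewrite addr0 add0r.
by move=> [df <-]; split; rewrite /derivable /derive -e.
Qed.

End ChainRule.

(** * Elementary properties of charts *)

Section Charts.
Context {R : realType} {T : topologicalType} {E : normedModType R}.
Variable c : chart T E.
Hypothesis cP : is_chart c.

Lemma chart_dom_open : open (chart_dom c). Proof. by have [[]] := cP. Qed.
Lemma chart_cod_open : open (chart_cod c). Proof. by have [[]] := cP. Qed.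

Lemma chart_map_cod x : chart_dom c x -> chart_cod c (chart_map c x).
Proof. by have [_ H _ _ _] := cP; move=> /H[]. Qed.

Lemma chart_mapK x : chart_dom c x -> chart_inv c (chart_map c x) = x.
Proof. by have [_ H _ _ _] := cP; move=> /H[]. Qed.

Lemma chart_inv_dom v : chart_cod c v -> chart_dom c (chart_inv c v).
Proof. by have [_ _ H _ _] := cP; move=> /H[]. Qed.

Lemma chart_invK v : chart_cod c v -> chart_map c (chart_inv c v) = v.
Proof. by have [_ _ H _ _] := cP; move=> /H[]. Qed.

Lemma chart_map_continuous x : chart_dom c x -> {for x, continuous (chart_map c)}.
Proof.
have [_ _ _ + _] := cP; rewrite continuous_open_subspace; last exact: chart_dom_open.
by move=> H cx; apply: H; rewrite inE.
Qed.

Lemma chart_inv_continuous v : chart_cod c v -> {for v, continuous (chart_inv c)}.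
Proof.
have [_ _ _ _ +] := cP; rewrite continuous_open_subspace; last exact: chart_cod_open.
by move=> H cx; apply: H; rewrite inE.
Qed.

Lemma near_chart_dom x : chart_dom c x -> \forall y \near x, chart_dom c y.
Proof. by move=> cx; apply: open_nbhs_nbhs; split => //; exact: chart_dom_open. Qed.

Lemma near_chart_cod v : chart_cod c v -> \forall w \near v, chart_cod c w.
Proof. by move=> cx; apply: open_nbhs_nbhs; split => //; exact: chart_cod_open. Qed.

End Charts.

(** * Flows of the action in charts *)

Section ProblemGeometry.
Context {R : realType} (P : problem R).
Local Notation n := (pb_gdim P).
Local Notation m := (pb_dim P).
Local Notation G := (pb_group P).
Local Notation M := (pb_space P).
Local Notation GA := (pb_gatlas P).
Local Notation MA := (pb_atlas P).
Local Notation exp := (@pb_exp _ P).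
Local Notation act := (@pb_act _ P).

Lemma gatlas_manifold : is_manifold GA. Proof. by have [] := pb_groupP P. Qed.

Lemma gchart_at x : [/\ charts GA (chart_at GA x), is_chart (chart_at GA x) &
  chart_dom (chart_at GA x) x].
Proof.
have [_ H _ K] := gatlas_manifold; have [ch cx] := K x; split=> //; exact: H.
Qed.

Lemma mchart_at x : [/\ charts MA (chart_at MA x), is_chart (chart_at MA x) &
  chart_dom (chart_at MA x) x].
Proof.
have [_ H _ K] := pb_spaceP P; have [ch cx] := K x; split=> //; exact: H.
Qed.

Lemma mchartP d : charts MA d -> is_chart d.
Proof. by have [_ H _ _] := pb_spaceP P; exact: H. Qed.

(** [exp (0 *: u)] is idempotent, hence the unit. *)
Lemma exp0 u : exp (0 *: u) = 1%g.
Proof.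
have [_ + _] := pb_expP (p := P) u => /(_ 0 0); rewrite addr0 => e.
have := congr1 (fun x => (x * (exp (0 *: u))^-1)%g) e.
by rewrite -mulgA mulgV mulg1.
Qed.

Lemma expD u s t : exp ((s + t) *: u) = (exp (s *: u) * exp (t *: u))%g.
Proof. by have [_ + _] := pb_expP (p := P) u; apply. Qed.

Lemma exp_continuous u : continuous (fun t : R => exp (t *: u)).
Proof. by have [[]] := pb_expP (p := P) u. Qed.

Lemma act1 q : act 1%g q = q. Proof. by have [] := pb_actP P. Qed.

Lemma actM g h q : act (g * h)%g q = act g (act h q).
Proof. by have [_ + _] := pb_actP P; apply. Qed.

Lemma act_continuous : continuous (fun z : G * M => act z.1 z.2).
Proof. by have [_ _ []] := pb_actP P. Qed.

Definition expflow (u : 'rV[R]_n) (t : R) (q : M) : M := act (exp (t *: u)) q.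

Lemma expflow0 u q : expflow u 0 q = q.
Proof. by rewrite /expflow exp0 act1. Qed.

Lemma expflowD u s t q : expflow u (s + t) q = expflow u s (expflow u t q).
Proof. by rewrite /expflow expD actM. Qed.

Lemma expflowN u t q : expflow u (- t) q = expflow (- u) t q.
Proof. by rewrite /expflow scaleNr scalerN. Qed.

Lemma expflow_continuous u q : continuous (fun t : R => expflow u t q).
Proof.
move=> t.
have e : (exp (s *: u), q) @[s --> t] --> (exp (t *: u), q).
  by apply: cvg_pair; [exact: exp_continuous|exact: cvg_cst].
exact: (cvg_comp _ _ e (@act_continuous (exp (t *: u), q))).
Qed.

Let c := chart_at GA 1%g.
Let xe := chart_map c 1%g.

Definition act_chart (d : chart M 'rV[R]_m) (z : 'rV[R]_n * 'rV[R]_m) : 'rV[R]_m :=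
  chart_map d (act (chart_inv c z.1) (chart_inv d z.2)).

Definition act_dom (d : chart M 'rV[R]_m) : set ('rV[R]_n * 'rV[R]_m) :=
  [set v | chart_cod (prod_chart c d) v /\
           chart_dom d (act (chart_inv c v.1) (chart_inv d v.2))].

Lemma unit_chart : [/\ charts GA c, is_chart c & chart_dom c 1%g].
Proof. exact: gchart_at. Qed.

Lemma act_chart_smooth d : charts MA d -> smooth_on (act_dom d) (act_chart d).
Proof.
move=> chd; have [_ _ [_ H]] := pb_actP P.
apply: (H (prod_chart c d) d) => //.
by exists c, d; split => //; have [] := unit_chart.
Qed.

Lemma act_dom_unit d z : charts MA d -> chart_cod d z -> act_dom d (xe, z).
Proof.
move=> /mchartP dP dz; have [_ cP c1] := unit_chart.
split; first by split => //=; exact: chart_map_cod.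
by rewrite /= chart_mapK// act1; exact: chart_inv_dom.
Qed.

Lemma act_chart_differentiable d z : charts MA d -> chart_cod d z ->
  differentiable (act_chart d) (xe, z).
Proof.
move=> chd dz; have [H _] := act_chart_smooth chd 1.
by apply: H; exact: act_dom_unit.
Qed.

Lemma near_expflow_dom d u q : charts MA d -> chart_dom d q ->
  \forall s \near (0 : R), chart_dom d (expflow u s q).
Proof.
move=> /mchartP dP dq; have := @expflow_continuous u q 0.
rewrite /continuous_at expflow0; apply.
exact: near_chart_dom.
Qed.

(** In coordinates the orbit is [act_chart d] along the curve [k], whose velocity at 0 is [(u, 0)];
    the chain rule needs differentiability only at the unit. *)
Lemma chart_expflow_derive d u q : charts MA d -> chart_dom d q ->
  is_derive (0 : R^o) (1 : R^o) (fun s => chart_map d (expflow u s q))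
    ('d (act_chart d) (xe, chart_map d q) (u, 0)).
Proof.
move=> chd dq; have dP := mchartP chd; have [_ cP c1] := unit_chart.
have [_ _ []] := pb_expP (p := P) u; rewrite exp0 -/c => ce dce.
pose k (s : R) := (chart_map c (exp (s *: u)), chart_map d q).
have dk : is_derive (0 : R^o) (1 : R^o) k (u, 0).
  have dc : differentiable (chart_map c \o (fun s : R => exp (s *: u)) : R^o -> 'rV[R]_n) 0.
    by apply/derivable1_diffP; exact: ex_derive.
  have dd : differentiable (cst (chart_map d q) : R^o -> 'rV[R]_m) 0.
    exact: differentiable_cst.
  have dkk : differentiable (k : R^o -> _) 0 by exact: (differentiable_pair dc dd).
  apply: DeriveDef; first exact: diff_derivable.
  rewrite deriveE//.
  rewrite [X in X _ = _](diff_pair dc dd) /= diff_cst.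
  by rewrite -deriveE// derive_val.
have k0 : k 0 = (xe, chart_map d q) by rewrite /k exp0.
have := is_derive_comp_differentiable dk.
rewrite k0 => /(_ _ _ (act_chart_differentiable chd (chart_map_cod dP dq))).
apply: near_eq_is_derive.
have ne : \forall s \near (0 : R), chart_dom c (exp (s *: u)).
  by have := @exp_continuous u 0; rewrite /continuous_at exp0; apply; exact: near_chart_dom.
near=> s.
rewrite /= /act_chart /k /= chart_mapK//; last by near: s.
by rewrite chart_mapK.
Unshelve. all: by end_near. Qed.

Variable p : M.
Let d := chart_at MA p.

Lemma base_chart : [/\ charts MA d, is_chart d & chart_dom d p].
Proof. exact: mchart_at. Qed.

(** The test functions are smooth on the whole domain of the fixed chart at [p], so applying
    derivations repeatedly never shrinks the neighbourhood. *)
Definition smooth_near : set (M -> R) :=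
  [set psi : M -> R | smooth_on (chart_cod d) (psi \o chart_inv d : 'rV[R]_m -> R^o)].

(** The fundamental vector field of the [i]-th basis vector of the Lie algebra, in the chart at [p]:
    a partial derivative of the action in a group direction at the unit. *)
Definition fund_field (i : 'I_n) (z : 'rV[R]_m) : 'rV[R]_m :=
  'D_(delta_mx 0 i, 0) (act_chart d) (xe, z).

(* In the fixed chart at p, X_i psi = sum_j W_ij D_j psi; its smoothness needs
   products and slices of C^k maps, but not their composition. *)
Definition fund_deriv (i : 'I_n) (psi : M -> R) (q : M) : R :=
  \sum_j fund_field i (chart_map d q) 0 j *
    'D_(delta_mx 0 j) (psi \o chart_inv d : 'rV[R]_m -> R^o) (chart_map d q).

Lemma fund_field_smooth i : smooth_on (chart_cod d) (fund_field i).
Proof.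
have [chd dP _] := base_chart; move=> k.
have H : smooth_on (act_dom d) ('D_(delta_mx 0 i, 0) (act_chart d)).
  exact: smooth_on_derive (act_chart_smooth chd).
apply: Ck_on_subset (Ck_on_slice xe (H k)) => z dz.
exact: act_dom_unit.
Qed.

Lemma smooth_near_fund_deriv i psi : smooth_near psi -> smooth_near (fund_deriv i psi).
Proof.
have [chd dP _] := base_chart; move=> spsi; have oU := chart_cod_open dP.
pose g (z : 'rV[R]_m) : R^o := \sum_j (fund_field i z 0 j : R^o) *
    'D_(delta_mx 0 j) (psi \o chart_inv d : 'rV[R]_m -> R^o) z.
have sg : smooth_on (chart_cod d) g.
  apply: smooth_on_sum => // j k; apply: Ck_onM => //.
    by apply: Ck_on_coord => //; exact: fund_field_smooth.
  exact: smooth_on_derive.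
move=> k; apply: Ck_on_eq (sg k) => // z Uz.
by rewrite /= /fund_deriv chart_invK.
Qed.

Lemma smooth_near_differentiable psi z : smooth_near psi -> chart_cod d z ->
  differentiable (psi \o chart_inv d : 'rV[R]_m -> R^o) z.
Proof. by move=> spsi dz; have [H _] := spsi 1; exact: H. Qed.

(** Linearity of both differentials: [u] is expanded in the basis of the Lie algebra, then each
    fundamental field in the coordinate basis. *)
Lemma fund_deriv_diff psi u q : smooth_near psi -> chart_dom d q ->
  'd (psi \o chart_inv d : 'rV[R]_m -> R^o) (chart_map d q)
    ('d (act_chart d) (xe, chart_map d q) (u, 0)) =
  lie fund_deriv u (dirac_at q) psi.
Proof.
have [chd dP _] := base_chart; move=> spsi dq; have dz := chart_map_cod dP dq.
have dact := act_chart_differentiable chd dz.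
have dpsi := smooth_near_differentiable spsi dz.
have -> : (u, 0) = \sum_i u 0 i *: (delta_mx 0 i, 0) :> 'rV[R]_n * 'rV[R]_m.
  rewrite {1}[u]row_sum_delta; elim/big_rec2 : _ => // i x y _ <-.
  by rewrite -[RHS]/(_ + _, _ *: 0 + 0) scaler0 addr0.
rewrite linear_sum linear_sum /lie; apply: eq_bigr => i _.
rewrite !linearZ; congr (_ * _).
have -> : 'd (act_chart d) (xe, chart_map d q) (delta_mx 0 i, 0) =
    fund_field i (chart_map d q) by rewrite -deriveE.
rewrite [fund_field i _]row_sum_delta linear_sum.
by apply: eq_bigr => j _; rewrite linearZ -deriveE.
Qed.

Lemma smooth_near_expflow_derive psi u q : smooth_near psi -> chart_dom d q ->
  is_derive (0 : R^o) (1 : R^o) (fun s => psi (expflow u s q))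
    (lie fund_deriv u (dirac_at q) psi).
Proof.
have [chd dP _] := base_chart; move=> spsi dq.
have := is_derive_comp_differentiable (chart_expflow_derive u chd dq).
rewrite expflow0 => /(_ _ _ (smooth_near_differentiable spsi (chart_map_cod dP dq))).
rewrite fund_deriv_diff//; apply: near_eq_is_derive.
have := near_expflow_dom u chd dq => H; near=> s.
by rewrite /= chart_mapK//; near: s.
Unshelve. all: by end_near. Qed.

(** The group law moves time [t] to time 0 at the point [expflow u t q]. *)
Lemma smooth_near_flow_derive psi u q t : smooth_near psi ->
  chart_dom d (expflow u t q) ->
  is_derive (t : R^o) (1 : R^o) (fun s => psi (expflow u s q))
    (lie fund_deriv u (dirac_at (expflow u t q)) psi).
Proof.
move=> spsi dq; apply: is_derive_translate.
have := smooth_near_expflow_derive u spsi dq; congr is_derive.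
by apply/funext => s; rewrite expflowD.
Qed.

Lemma smooth_near_bounded psi : smooth_near psi ->
  exists C : R, \forall q \near p, `|psi q| <= C.
Proof.
have [chd dP dp] := base_chart; move=> spsi.
have cpsi : psi q @[q --> p] --> psi p.
  have := cvg_comp _ _ (chart_map_continuous dP dp) (spsi 0%N _ (chart_map_cod dP dp)).
  rewrite /= chart_mapK//; apply: cvg_trans; apply: near_eq_cvg.
  have := near_chart_dom dP dp; apply: filterS => q dq.
  by rewrite /= chart_mapK.
exists (`|psi p| + 1).
have := @cvgr_norm_le _ _ _ _ _ _ _ cpsi; apply.
by rewrite ltrDl.
Qed.

(** With coordinates among the test functions, the derivative formula also controls the displacement
    of the flow in the chart. *)
Lemma chart_coord_smooth_near j : smooth_near (fun q => chart_map d q 0 j).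
Proof.
have [chd dP dp] := base_chart; have oU := chart_cod_open dP.
have sid k : Ck_on k (chart_cod d) (id : 'rV[R]_m -> 'rV[R]_m).
  case: k => [|k]; first by move=> x _; exact: cvg_id.
  split=> // v; rewrite (_ : (fun x => _) = cst v); first exact: Ck_on_cst.
  by apply/funext => x; rewrite derive_id.
move=> k; apply: Ck_on_eq (Ck_on_coord j oU (sid k)) => // z Uz.
by rewrite /= chart_invK.
Qed.

End ProblemGeometry.

Lemma rV_norm_le (R : realType) m (z : 'rV[R]_m) (e : R) : 0 <= e ->
  (forall j, `|z 0 j| <= e) -> `|z| <= e.
Proof.
move=> e0 H; rewrite /Num.Def.normr/= mx_normrE; apply: bigmax_le => // -[i j] _.
by rewrite /= (ord1 i).
Qed.

(** * Confinement of the flow and velocities near the starting point *)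

Section Local.
Context {R : realType} (P : problem R) (p : pb_space P).
Local Notation n := (pb_gdim P).
Local Notation m := (pb_dim P).
Local Notation M := (pb_space P).
Local Notation MA := (pb_atlas P).
Let d := chart_at MA p.
Let x0 := chart_map d p.

Definition chart_ball (r : R) : set M :=
  [set q | chart_dom d q /\ `|chart_map d q - x0| < r].

Lemma near_chart_ball r q : chart_ball r q -> \forall q' \near q, chart_ball r q'.
Proof.
have [_ dP _] := base_chart p; move=> [dq rq].
have cq := chart_map_continuous dP dq.
have near_r : \forall z \near chart_map d q, `|z - x0| < r.
  have : ball x0 r (chart_map d q) by rewrite -ball_normE/= distrC.
  move=> b; have := open_nbhs_nbhs (conj (ball_open x0 r) b).
  by apply: filterS => z; rewrite -ball_normE/= distrC.
have H1 := cq _ near_r; have H2 := near_chart_dom dP dq.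
near=> y; split; first by near: y.
by near: y.
Unshelve. all: by end_near. Qed.

(* At the first exit time the flow would have left the image under chart_inv of a
   smaller closed ball, which is compact, hence closed since M is Hausdorff. *)
Lemma expflow_stays (r C K t : R) (u : 'rV[R]_n) (q : M) : 0 <= K -> 0 <= C -> 0 <= t ->
  (forall z, `|z - x0| < r -> chart_cod d z) ->
  (forall i j q', chart_ball r q' ->
    `|fund_deriv p i (fun q => chart_map d q 0 j) q'| <= C) ->
  chart_dom d q -> `|chart_map d q - x0| < r / 2 ->
  (forall i, `|u 0 i| <= K) -> n%:R * K * C * t < r / 2 ->
  chart_ball r (expflow u t q).
Proof.
have [chd dP _] := base_chart p.
move=> K0 C0 t0 codr bd dq rq uK tC.
apply: contrapT => nt.
have r0 : 0 < r by have := normr_ge0 (chart_map d q - x0); lra.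
have q0 : chart_ball r (expflow u 0 q).
  by rewrite expflow0; split=> //; lra.
pose Z := [set s : R | 0 <= s <= t /\ ~ chart_ball r (expflow u s q)].
have hZ : has_inf Z.
  split; first by exists t; rewrite /Z/= t0 lexx.
  by exists 0 => s [/andP[]].
pose T := inf Z.
have T0 : 0 <= T by apply: lb_le_inf; [have [] := hZ|move=> s [/andP[]]].
have Tt : T <= t by apply: ge_inf; [have [] := hZ|rewrite /Z/= t0 lexx].
have before s : 0 <= s < T -> chart_ball r (expflow u s q).
  move=> /andP[s0 sT]; apply: contrapT => ns.
  have : T <= s.
    apply: ge_inf; first by have [] := hZ.
    by split => //; rewrite s0 (le_trans (ltW sT)).
  by rewrite leNgt sT.
(* Staying in the ball is an open condition along the continuous flow, so the infimum is itself an
   exit time. *)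
have nT : ~ chart_ball r (expflow u T q).
  move=> /near_chart_ball => /(@expflow_continuous _ P u q T) [e /= e0 He].
  have [s Zs sTe] := inf_adherent e0 hZ.
  have Ts : T <= s by apply: ge_inf => //; have [] := hZ.
  have [_] := Zs; apply; apply: He => /=.
  rewrite distrC ger0_norm ?subr_ge0// ltrBlDr addrC; exact: sTe.
have T0' : 0 < T by rewrite lt_neqAle T0 andbT; apply/eqP => T00; apply: nT; rewrite -T00.
(* Initial distance plus maximal displacement up to time [t]; it is strictly below [r], which leaves
   room for the contradiction at [T]. *)
pose rho := r / 2 + n%:R * K * C * t.
have rhor : rho < r by rewrite /rho; lra.
have L0 : 0 <= n%:R * K * C by rewrite !mulr_ge0.
have rho0 : 0 < rho by rewrite /rho ltr_wpDr ?divr_gt0// mulr_ge0.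
pose S := chart_inv d @` closed_ball x0 rho.
have Sbd s : 0 <= s < T -> S (expflow u s q).
  move=> sT; have [ds _] := before s sT.
  have [s0 sT'] := andP sT.
  exists (chart_map d (expflow u s q)); last exact: chart_mapK.
  rewrite closed_ballE// /closed_ball_/= distrC.
  rewrite -(subrKA (chart_map d q)) (le_trans (ler_normD _ _))// addrC lerD//; first exact: ltW.
  (* Each coordinate changes along the flow at a rate of at most [n%:R * K * C], and the norm is the
     maximum over the coordinates. *)
  rewrite rV_norm_le ?mulr_ge0// => j; rewrite !mxE.
  have := @le_norm_derive_segment R (fun s => chart_map d (expflow u s q) 0 j)
    (fun s => lie (fund_deriv p) u (dirac_at (expflow u s q)) (fun q => chart_map d q 0 j))
    (n%:R * K * C) 0 s s0.
  rewrite expflow0 subr0 => /(_ _ _)/le_trans; apply.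
  - move=> x /andP[x0_ xs]; apply: smooth_near_flow_derive.
      exact: chart_coord_smooth_near.
    by have [] := before x; rewrite ?x0_ ?(le_lt_trans xs).
  - move=> x /andP[x0_ xs]; rewrite /lie (le_trans (ler_norm_sum _ _ _))//.
    rewrite (@le_trans _ _ (\sum_(i < n) K * C))//; last first.
      by rewrite sumr_const card_ord -mulrA -[X in X <= _]mulr_natl.
    apply: ler_sum => i _; rewrite normrM ler_pM//; apply: bd.
    by apply: before; rewrite x0_ (le_lt_trans xs).
  - by rewrite ler_wpM2l// (le_trans (ltW sT')).
have Scl : closed S.
  have [[hM _] _ _ _] := pb_spaceP P.
  apply: compact_closed => //; apply: continuous_compact.
    apply/continuous_in_subspaceT => z; rewrite inE => rz.
    apply: chart_inv_continuous => //; apply: codr.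
    by move: rz; rewrite closed_ballE// /closed_ball_/= distrC => /le_lt_trans; apply.
  apply: bounded_closed_compact; last exact: closed_ball_closed.
  exists (`|x0| + rho); split; first exact: num_real.
  move=> N xN z; rewrite closed_ballE// /closed_ball_/= distrC => zr.
  rewrite (le_trans _ (ltW xN))// -[z](subrK x0) addrC (le_trans (ler_normD _ _))//.
  by rewrite lerD2l.
have ST : S (expflow u T q).
  apply: contrapT => nS.
  have : \forall q' \near expflow u T q, ~ S q'.
    by apply: open_nbhs_nbhs; split => //; exact: closed_openC.
  move=> /(@expflow_continuous _ P u q T) [e /= e0 He].
  (* A time before [T] but within [e] of it; the maximum keeps it nonnegative. *)
  pose s := Num.max 0 (T - e / 2).
  have sT : 0 <= s < T.
    by rewrite le_max lexx /= gt_max T0' /= gtrBl divr_gt0.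
  apply: (He s); last exact: Sbd.
  have [s0 sT'] := andP sT.
  rewrite /= ger0_norm ?subr_ge0 ?ltW//.
  have : T - e / 2 <= s by rewrite /s le_max lexx orbT.
  by lra.
case: ST nT => z; rewrite closed_ballE// /closed_ball_/= distrC => zr <- nz.
have zc : chart_cod d z by apply: codr; exact: le_lt_trans rhor.
apply: nz; split; first exact: chart_inv_dom.
by rewrite chart_invK// (le_lt_trans zr).
Qed.

Lemma expflow_local (K : R) (V : set M) : 0 <= K -> nbhs p V ->
  exists2 L : R, 0 < L & \forall q \near p, forall (u : 'rV[R]_n) (t : R),
    (forall i, `|u 0 i| <= K) -> `|t| * L < 1 -> V (expflow u t q).
Proof.
have [chd dP dp] := base_chart p.
move=> K0 Vp.
have /choice[B HB] (ij : 'I_n * 'I_m) : exists B : R, \forall q \near p,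
    `|fund_deriv p ij.1 (fun q => chart_map d q 0 ij.2) q| <= B.
  apply: smooth_near_bounded; apply: smooth_near_fund_deriv.
  exact: chart_coord_smooth_near.
pose C := \sum_ij `|B ij|.
have C0 : 0 <= C by exact: sumr_ge0.
have BC i j : B (i, j) <= C.
  by rewrite (le_trans (ler_norm _))// /C (bigD1 (i, j))//= lerDl sumr_ge0.
(* The target [V] and the derivative bounds are gathered in one neighbourhood, so that a single
   radius [r] serves both. *)
pose N : set M := [set q | V q /\ forall ij : 'I_n * 'I_m,
    `|fund_deriv p ij.1 (fun q => chart_map d q 0 ij.2) q| <= B ij].
have Np : nbhs p N.
  apply: filterI => //.
  exact: (@filter_forall _ _ (fun ij q =>
    `|fund_deriv p ij.1 (fun q => chart_map d q 0 ij.2) q| <= B ij) (nbhs p) _ HB).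
have x0d : chart_cod d x0 by exact: chart_map_cod.
have : \forall z \near x0, chart_cod d z /\ N (chart_inv d z).
  apply: filterI; first exact: (near_chart_cod dP x0d).
  by apply: (chart_inv_continuous dP x0d); rewrite /= /x0 chart_mapK.
move=> /nbhs_ballP[r /= r0 Hr].
have rball z : `|z - x0| < r -> chart_cod d z /\ N (chart_inv d z).
  by move=> zr; apply: Hr; rewrite -ball_normE/= distrC.
have rN q : chart_ball r q -> N q.
  by move=> [dq /rball[_]]; rewrite chart_mapK.
have nKC : 0 <= n%:R * K * C by rewrite !mulr_ge0.
(* Then [|t| * L < 1] keeps the displacement below [r / 2]; the added 1 makes [L] positive even if
   the velocity bound vanishes. *)
exists ((n%:R * K * C + 1) * (2 / r)).
  by rewrite mulr_gt0 ?divr_gt0// ltr_wpDl.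
have r2 : chart_ball (r / 2) p by split=> //; rewrite subrr normr0 divr_gt0.
have := near_chart_ball r2; apply: filterS => q [dq rq].
(* Negative times reduce to positive ones by replacing [u] with [- u], which satisfies the same
   bound. *)
have pos (u : 'rV[R]_n) (t : R) : (forall i, `|u 0 i| <= K) -> 0 <= t ->
    t * ((n%:R * K * C + 1) * (2 / r)) < 1 -> V (expflow u t q).
  move=> uK t0 tL; suff /rN[] : chart_ball r (expflow u t q) by [].
  apply: (@expflow_stays r C K t) => // [z /rball[]//|i j q' /rN[_ /(_ (i, j))]|].
    by move=> /le_trans; apply.
  rewrite (@le_lt_trans _ _ (t * (n%:R * K * C + 1)))//.
    by rewrite mulrC ler_wpM2l// lerDl.
  by move: tL; rewrite mulrA -invf_div ltr_pdivrMr ?divr_gt0// mul1r.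
move=> u t uK tL; have [t0|t0] := leP 0 t.
  by apply: pos => //; rewrite -[t]ger0_norm.
rewrite -[t]opprK expflowN; apply: pos => [i||].
- by rewrite mxE normrN.
- by rewrite oppr_ge0 ltW.
- by rewrite -ltr0_norm.
Qed.

Lemma expflow_local_flow :
  local_flow p (smooth_near p) (fund_deriv p) (@expflow R P).
Proof.
have [chd dP dp] := base_chart p; split.
- exact: smooth_near_fund_deriv.
- exact: smooth_near_bounded.
- exact: expflow0.
- exists (chart_dom d); first exact: near_chart_dom.
  by move=> psi u q t; exact: smooth_near_flow_derive.
- exact: expflow_local.
Qed.

Lemma lambda_starE q u : lambda_star u q =
  'd (act_chart (chart_at MA q)) (chart_map (chart_at (pb_gatlas P) 1%g) 1%g,
     chart_map (chart_at MA q) q) (u, 0).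
Proof.
have [chd' _ d'q] := mchart_at q.
have H := chart_expflow_derive u chd' d'q.
by rewrite /lambda_star derive1E -[RHS](@derive_val _ _ _ _ _ _ _ H).
Qed.

(* The velocity of y is given in the chart at y t, not in the chart at p; instead
   of changing charts, compare with the flow of u through y t, which has the same
   velocity. *)
Lemma velocity_derive (psi : M -> R) (y : R -> M) (t : R) u :
  smooth_near p psi -> chart_dom d (y t) ->
  has_velocity MA y t (lambda_star u (y t)) ->
  is_derive (t : R^o) (1 : R^o) (fun s => psi (y s))
    (lie (fund_deriv p) u (dirac_at (y t)) psi).
Proof.
have [chd dP dp] := base_chart p; move=> spsi dq [cy vy].
set q := y t in dq vy *; pose d' := chart_at MA q.
have [chd' d'P d'q] := mchart_at q; rewrite -/d' in chd' d'P d'q.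
have d'x := chart_map_cod d'P d'q.
(* The transition map carries differentiability of [psi] from the chart at [p] to the chart at
   [q]. *)
have dpsi : differentiable (psi \o chart_inv d' : 'rV[R]_m -> R^o) (chart_map d' q).
  have [_ _ tr _] := pb_spaceP P.
  have [dtr _] := tr _ _ chd' chd 1.
  have dtrq : differentiable (chart_map d \o chart_inv d') (chart_map d' q).
    by apply: dtr; split => //=; rewrite chart_mapK.
  have dpd : differentiable (psi \o chart_inv d : 'rV[R]_m -> R^o)
      ((chart_map d \o chart_inv d') (chart_map d' q)).
    apply: smooth_near_differentiable => //=; rewrite chart_mapK//.
    exact: chart_map_cod.
  apply: near_eq_differentiable (differentiable_comp dtrq dpd).
  have : \forall v \near chart_map d' q, chart_dom d (chart_inv d' v).
    apply: (chart_inv_continuous d'P d'x); rewrite chart_mapK//.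
    exact: near_chart_dom.
  by apply: filterS => v dv; rewrite /= chart_mapK.
have along (z : R -> M) (s : R) (v : 'rV[R]_m) : z s = q -> {for s, continuous z} ->
    is_derive (s : R^o) (1 : R^o) (chart_map d' \o z) v ->
    is_derive (s : R^o) (1 : R^o) (fun x => psi (z x))
      ('d (psi \o chart_inv d' : 'rV[R]_m -> R^o) (chart_map d' q) v).
  move=> zs cz dz; have := is_derive_comp_differentiable dz.
  rewrite /= zs => /(_ _ _ dpsi); apply: near_eq_is_derive.
  have : \forall x \near s, chart_dom d' (z x).
    by apply: cz; rewrite zs; exact: near_chart_dom.
  by apply: filterS => x dx; rewrite /= chart_mapK.
suff <- : 'd (psi \o chart_inv d' : 'rV[R]_m -> R^o) (chart_map d' q)
    (lambda_star u q) = lie (fund_deriv p) u (dirac_at q) psi by exact: along.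
have H1 := smooth_near_expflow_derive u spsi dq.
have H2 : is_derive (0 : R^o) (1 : R^o) (fun s => psi (expflow u s q))
   ('d (psi \o chart_inv d' : 'rV[R]_m -> R^o) (chart_map d' q) (lambda_star u q)).
  apply: along; first exact: expflow0.
    exact: expflow_continuous.
  by rewrite lambda_starE; exact: chart_expflow_derive.
by rewrite -[LHS](@derive_val _ _ _ _ _ _ _ H2) (@derive_val _ _ _ _ _ _ _ H1).
Qed.

Lemma smooth_map_smooth_near k (g : M -> 'rV[R]_k) j :
  smooth_map MA (model_atlas 'rV[R]_k) g -> smooth_near p (fun q => g q 0 j).
Proof.
have [chd dP dp] := base_chart p; move=> [_ /(_ d (model_chart 'rV[R]_k) chd erefl) sg].
move=> l; apply: (@Ck_on_coord _ _ _ _ _ (g \o chart_inv d)); first exact: chart_cod_open.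
by apply: Ck_on_subset (sg l) => z.
Qed.

Lemma smooth_fun_smooth_near (psi : M -> R^o) :
  smooth_map MA (model_atlas R^o) psi -> smooth_near p psi.
Proof.
have [chd dP dp] := base_chart p; move=> [_ /(_ d (model_chart R^o) chd erefl) sg].
by move=> l; apply: Ck_on_subset (sg l) => z.
Qed.

End Local.

(** Passes from velocities in moving charts to derivatives along the test functions at [p], the form
    on which the expansions operate. *)
Lemma Oh_has_order (R : realType) (q : nat) (Phi : scheme R) :
  (forall (P : problem R) (y : R -> pb_space P) (p : pb_space P),
    y 0 = p -> y t @[t --> (0 : R)] --> p ->
    (forall psi, smooth_near p psi -> \forall t \near (0 : R),
      is_derive t (1 : R) (fun s => psi (y s))
        (lie (fund_deriv p) (pb_f (y t)) (dirac_at (y t)) psi)) ->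
    forall psi, smooth_near p psi -> Oh q.+1 (fun h => psi (y h) - psi (Phi P h p))) ->
  has_order q Phi.
Proof.
move=> H P phi ephi psi spsi p; have [phi0 vphi] := ephi p.
have [chd dP dp] := base_chart p.
have cphi : phi t p @[t --> (0 : R)] --> p.
  (* A property that holds near 0 holds at 0, and a velocity there includes continuity. *)
  have [c0 _] := nbhs_singleton vphi.
  by have : phi t p @[t --> (0 : R)] --> phi 0 p := c0; rewrite phi0.
have [|C HC] := H P (fun t => phi t p) p phi0 cphi _ psi (smooth_fun_smooth_near p spsi).
  move=> chi schi; have H1 := cphi _ (near_chart_dom dP dp).
  near=> t; apply: velocity_derive => //; first by near: t.
  by near: t.
apply/eqO_exP; exists (Num.max C 1); first by rewrite lt_max ltr01 orbT.
near=> h; rewrite [X in _ <= _ * X]normrX.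
apply: (@le_trans _ _ (C * `|h| ^+ q.+1)); first by near: h.
by rewrite ler_wpM2r ?exprn_ge0// le_max lexx.
Unshelve. all: by end_near. Qed.

(** * The coefficients of the scheme satisfy the order conditions *)

Section CommutatorFreeOrder.
Context {R : realType} (a gamma : R).
Hypothesis hgamma : 4 * a * (3 * a - 1) * gamma ^+ 2
                    + 4 * (3 * a - 1) * gamma + 3 = 0.

(** The terms in [a * gamma] cancel, leaving [gamma * a32 = 1 / 2], which is the quadratic equation
    for [gamma]; [cf3_order3a] is the same identity divided by 3. *)
Lemma cf3_order2 : - (3 * a * gamma) / 3 + gamma * (a + cf3_a32 a gamma) = 1 / 2.
Proof.
have -> : - (3 * a * gamma) / 3 + gamma * (a + cf3_a32 a gamma) =
  1 / 2 - (4 * a * (3 * a - 1) * gamma ^+ 2 + 4 * (3 * a - 1) * gamma + 3) / 6.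
  by rewrite /cf3_a32; field.
by rewrite hgamma mul0r subr0.
Qed.

Lemma cf3_order3a : gamma * cf3_a32 a gamma / 3 = 1 / 6.
Proof. by have := cf3_order2; lra. Qed.

(** The constant term 3 of the quadratic excludes [gamma = 0], so [a32] is the inverse of
    [2 * gamma]; the defect of the condition is then the quadratic divided by [12 * gamma]. *)
Lemma cf3_order3b : - (3 * a * gamma) / 9 + gamma * (a + cf3_a32 a gamma) ^+ 2 = 1 / 3.
Proof.
have g0 : gamma != 0.
  apply/eqP => g0; move: hgamma; rewrite g0 expr0n !mulr0 !add0r.
  by move/eqP; rewrite pnatr_eq0.
have -> : cf3_a32 a gamma = (2 * gamma)^-1.
  apply: (mulfI g0); have -> : gamma * cf3_a32 a gamma = 1 / 2.
    by have := cf3_order3a; lra.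
  by field; rewrite g0.
have -> : - (3 * a * gamma) / 9 + gamma * (a + (2 * gamma)^-1) ^+ 2 = 1 / 3 +
  (4 * a * (3 * a - 1) * gamma ^+ 2 + 4 * (3 * a - 1) * gamma + 3) / (12 * gamma).
  by field; rewrite g0.
by rewrite hgamma mul0r addr0.
Qed.

Lemma cf3_order1 : ((3 * a - 1) * gamma + 2 / 3) + - (3 * a * gamma) + gamma = 2 / 3.
Proof. by field. Qed.

Section Stages.
Variables (P : problem R) (p : pb_space P).
Local Notation fl := (@expflow R P).
Local Notation f := (@pb_f R P).
Local Notation a32 := (cf3_a32 a gamma).

Lemma cf3_f1E : cf3_f1 p = f p.
Proof. by rewrite /cf3_f1 act1. Qed.

(** The factor 1/3 moves from the time to the vector, so that every exponential is a flow over time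
    [h]. *)
Lemma cf3_g2E h : pb_act (cf3_g2 h p) p = fl (3^-1 *: f p) h p.
Proof. by rewrite /expflow scalerA /cf3_g2 cf3_f1E. Qed.

Lemma cf3_f2E h : cf3_f2 h p = cf_f2 p fl f 3^-1 h.
Proof. by rewrite /cf3_f2 cf3_g2E. Qed.

Lemma cf3_f3E h : cf3_f3 a gamma h p = cf_f3 p fl f a a32 3^-1 h.
Proof. by rewrite /cf3_f3 /cf3_g3 cf3_f1E cf3_f2E. Qed.

Lemma cf3_updateE h : cf3_update a gamma h p =
  cf_upd p fl f ((3 * a - 1) * gamma + 2 / 3) (- (3 * a * gamma)) gamma a a32 3^-1 h.
Proof.
by rewrite /cf3_update actM -/(cf3_g2 h p) cf3_g2E cf3_f1E cf3_f2E cf3_f3E -scaleNr.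
Qed.

Lemma cf3_embeddedE b1 b2 b3 b4 h : cf3_embedded a gamma b1 b2 b3 b4 h p =
  cf_emb p fl f ((3 * a - 1) * gamma + 2 / 3) (- (3 * a * gamma)) gamma a a32 3^-1
    b1 b2 b3 b4 h.
Proof.
by rewrite /cf3_embedded cf3_f1E cf3_f2E cf3_f3E /cf3_f4 cf3_updateE.
Qed.

End Stages.
End CommutatorFreeOrder.

Theorem mainTheorem4 (R : realType) (a gamma : R)
    (hgamma : 4 * a * (3 * a - 1) * gamma ^+ 2
              + 4 * (3 * a - 1) * gamma + 3 = 0) :
  has_order 3 (cf3_update a gamma) /\
  (forall b1 b2 b3 b4 : R,
     b1 + b2 + b3 + b4 = 1 ->
     1 / 3 * b2 + cf3_c3 a gamma * b3 + b4 = 1 / 2 ->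
     has_order 2 (cf3_embedded a gamma b1 b2 b3 b4)).
Proof.
have Af (P : problem R) (p : pb_space P) i : smooth_near p (fun q => pb_f q 0 i).
  exact: smooth_map_smooth_near (pb_fP P).
split=> [|b1 b2 b3 b4 e1 e2]; apply: Oh_has_order => P y p y0 yp dy psi spsi.
- have := cf_upd_order (expflow_local_flow p) (Af P p) erefl (cf3_order1 a gamma)
    (cf3_order2 hgamma) (cf3_order3a hgamma) (cf3_order3b hgamma) y0 yp dy spsi.
  by apply: ext_Oh => h; rewrite cf3_updateE.
- have e2' : b2 / 3 + (a + cf3_a32 a gamma) * b3 + b4 = 1 / 2.
    by rewrite -e2 /cf3_c3; field.
  have := cf_emb_order (expflow_local_flow p) (Af P p) erefl (cf3_order1 a gamma)
    (cf3_order2 hgamma) (cf3_order3a hgamma) (cf3_order3b hgamma) y0 yp dy e1 e2' spsi.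
  by apply: ext_Oh => h; rewrite cf3_embeddedE.
Qed.
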